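(* Let $G$ be a Cayley automatic group generated by a finite set $\{g_1,\dots,g_n\}\subset G$, and let $\psi_G: L_G\to G$ be a Cayley automatic representation of $G$ such that the empty word is not in $L_G$. Let $a$ be a generator of $\mathbb{Z}=\langle a\rangle$ and consider $G\wr\mathbb{Z}$ with the generating set $\{g_1,\dots,g_n,a\}$. For $j=1,\dots,n$ let $d_j$ be the maximum, over $g\in G$, of the number of padding symbols $\diamond$ in the convolution $\psi_G^{-1}(g)\otimes\psi_G^{-1}(g g_j)$. Let $K_0=|\psi_G^{-1}(e)|$, where $e\in G$ is the identity, and let $K=\max\{K_0, d_j \mid j=1,\dots,n\}$. Then there exists a Cayley automatic representation $\psi: L\to G\wr\mathbb{Z}$ of the group $G\wr\mathbb{Z}$ such that: (i) for every $g\in G\wr\mathbb{Z}$ and its representative $w=\psi^{-1}(g)$, $$\frac{1}{K}|w|-\frac{K_0}{K}\leqslant |g|;$$ (ii) if $C>0$ and $D\geqslant 0$ are such that $|g|\leqslant C|\psi_G^{-1}(g)|+D$ for all $g\in G$, then for every $g\in G\wr\mathbb{Z}$ and its representative $w=\psi^{-1}(g)$, $$|g|\leqslant (C+D+2)|w|-2.$$ Here $|g|$ denotes word length with respect to $\{g_1,\dots,g_n\}$ for $g\in G$, and with respect to $\{g_1,\dots,g_n,a\}$ for $g\in G\wr\mathbb{Z}$; for a word $w$, $|w|$ is its length.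
   Context: Wreath product: for groups $A,B$, let $A^{(B)}$ be the group of functions $B\to A$ with finite support (i.e. $f(x)\neq e$ for only finitely many $x$) under pointwise multiplication. For $f\in A^{(B)}$, $b\in B$ put $f^b(x)=f(bx)$. The restricted wreath product $A\wr B$ is the set of pairs $(f,b)$, $f\in A^{(B)}$, $b\in B$, with multiplication $(f,b)\cdot(f',b')=(f f'^{\,b^{-1}}, bb')$. The group $B$ is identified with the subgroup of elements $(\mathbf{e},b)$, where $\mathbf{e}$ is the identity of $A^{(B)}$; an element $c\in A$ is identified with $(f_c,e)$, where $f_c(e)=c$ and $f_c(x)=e$ for $x\neq e$. Convolution: for a finite alphabet $\Sigma$, let $\Sigma_\diamond=\Sigma\cup\{\diamond\}$ with $\diamond\notin\Sigma$ (the padding symbol). For $w_1,w_2\in\Sigma^*$, $w_1\otimes w_2$ is the word of length $\max\{|w_1|,|w_2|\}$ over $\Sigma_\diamond\times\Sigma_\diamond$ whose $k$th symbol is $(\sigma_1,\sigma_2)$, where $\sigma_i$ is the $k$th symbol of $w_i$ if $k\leqslant |w_i|$ and $\diamond$ otherwise. Cayley automatic representation: given a group $G$ and a finite generating set $S\subset G$, a Cayley automatic representation of $G$ (with respect to $S$) is a bijection $\psi:L\to G$, where $L\subset\Sigma^*$ is a regular language over some finite alphabet $\Sigma$, such that for each $s\in S$ the language $L_s=\{w_1\otimes w_2 \mid w_1,w_2\in L,\ \psi(w_1)s=\psi(w_2)\}$ is regular. A group is Cayley automatic if it has such a representation for some finite generating set; the notion is invariant under the choice of finite generating set. Here $\psi_G$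 is with respect to $\{g_1,\dots,g_n\}$ and $\psi$ is with respect to $\{g_1,\dots,g_n,a\}$. The word length $|g|$ with respect to a generating set $S$ is the least length of a word over $S\cup S^{-1}$ representing $g$. *)

(* Defs.v *)
From HB Require Import structures.
From Stdlib Require Import Classical.
From mathcomp Require Import all_boot all_order all_algebra.
From mathcomp Require Import finmap.
Set Implicit Arguments.
Unset Strict Implicit.
Unset Printing Implicit Defensive.

(* Library: MathComp with finmap. *)

Local Open Scope fset_scope.
Local Open Scope group_scope.

(* The additive group of integers, written multiplicatively. *)
Definition intZ : groupType := Algebra.to_multiplicative int.

Section WordLength.
Variable G : groupType.
Implicit Types (S : seq G) (g : G) (k : nat).

Definition symmetrize S : seq G := S ++ [seq s^-1 | s <- S].

Definition represents S k g : bool :=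
  [exists u : k.-tuple (seq_sub (symmetrize S)), \prod_(s <- u) val s == g].

Definition generates S : Prop := forall g, exists k, represents S k g.

Definition wlength S (genS : generates S) g : nat := ex_minn (genS g).

Lemma representsP S k g :
  reflect (exists u : seq G,
             [/\ size u = k, {subset u <= symmetrize S} & \prod_(s <- u) s = g])
          (represents S k g).
Proof.
apply: (iffP existsP) => [[u /eqP <-]|[u [<- sub_u <-]]].
  exists [seq val s | s <- u]; split; first by rewrite size_map size_tuple.
    by move=> x /mapP[s _ ->]; apply: valP.
  by rewrite big_map.
have : exists v : seq (seq_sub (symmetrize S)), map val v = u.
  elim: u sub_u => [|x u IHu] sub_u; first by exists [::].
  case: IHu => [y yu|v <-]; first by apply: sub_u; rewrite inE yu orbT.
  by exists (SeqSub (sub_u x (mem_head _ _)) :: v).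
case=> v <-; have sv : size v == size (map val v) by rewrite size_map.
by exists (Tuple sv); rewrite /= big_map.
Qed.

Lemma represents1 S : represents S 0 1.
Proof. by apply/representsP; exists [::]; rewrite big_nil. Qed.

Lemma representsM S k l g h :
  represents S k g -> represents S l h -> represents S (k + l) (g * h).
Proof.
move=> /representsP[u [<- uS <-]] /representsP[v [<- vS <-]].
apply/representsP; exists (u ++ v); rewrite size_cat big_cat; split=> // x.
by rewrite mem_cat => /orP[/uS|/vS].
Qed.

Lemma represents_gen S s : s \in symmetrize S -> represents S 1 s.
Proof.
move=> sS; apply/representsP; exists [:: s]; rewrite big_seq1; split=> // x.
by rewrite inE => /eqP->.
Qed.

End WordLength.

Record dfa (A : finType) := DFA {
  dfa_state : finType;
  dfa_start : dfa_state;
  dfa_final : {set dfa_state};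
  dfa_step : dfa_state -> A -> dfa_state
}.

Definition dfa_run (A : finType) (M : dfa A) (q : dfa_state M) (w : seq A) :=
  foldl (@dfa_step A M) q w.

Definition dfa_accept (A : finType) (M : dfa A) (w : seq A) : bool :=
  dfa_run (dfa_start M) w \in dfa_final M.

Definition regular (A : finType) (L : seq A -> Prop) : Prop :=
  exists M : dfa A, forall w, dfa_accept M w <-> L w.

(* The padding symbol is [None]. *)
Definition convolution (A : finType) (w1 w2 : seq A) :
    seq (option A * option A) :=
  mkseq (fun k => (onth w1 k, onth w2 k)) (maxn (size w1) (size w2)).

Definition paddings (A : finType) (c : seq (option A * option A)) : nat :=
  (count (fun p => p.1 == None) c + count (fun p => p.2 == None) c)%N.

(* The bijection [car_val] is given together with its inverse [car_rep].
   A regular language is decidable, so [car_lang] may be boolean. *)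
Record cayley_automatic_rep (G : groupType) (S : seq G) := CayleyAutomaticRep {
  car_symbol : finType;
  car_lang : pred (seq car_symbol);
  car_val : {w : seq car_symbol | car_lang w} -> G;
  car_rep : G -> {w : seq car_symbol | car_lang w};
  car_valK : cancel car_val car_rep;
  car_repK : cancel car_rep car_val;
  car_lang_regular : regular car_lang;
  car_mul_regular : forall s : G, s \in S ->
    regular (fun c => exists w1 w2 : {w : seq car_symbol | car_lang w},
      c = convolution (val w1) (val w2) /\ car_val w1 * s = car_val w2)
}.

Arguments car_symbol {G S} psi : rename.
Arguments car_lang {G S} psi w : rename.
Arguments car_val {G S} psi w : rename.
Arguments car_rep {G S} psi g : rename.

Definition repr_word (G : groupType) (S : seq G)
    (psi : cayley_automatic_rep S) (g : G) : seq (car_symbol psi) :=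
  val (car_rep psi g).

Definition is_maximum (P : nat -> Prop) (m : nat) : Prop :=
  P m /\ forall k, P k -> (k <= m)%N.

(* [padding_number psi s k]: the number of padding symbols [k] occurs for
   right multiplication by [s] at some element of the group. *)
Definition padding_number (G : groupType) (S : seq G)
    (psi : cayley_automatic_rep S) (s : G) (k : nat) : Prop :=
  exists g : G, k = paddings (convolution (repr_word psi g)
                                          (repr_word psi (g * s))).

Lemma bounded_maximum P b k0 :
  P k0 -> (forall k, P k -> (k <= b)%N) -> exists m, is_maximum P m.
Proof.
move=> Pk0; elim: b => [|b IHb] leb.
  by exists k0; split=> // k /leb; rewrite leqn0 => /eqP->.
have [Pb|NPb] := classic (P b.+1); first by exists b.+1.
apply: IHb => k Pk; rewrite -ltnS ltn_neqAle leb // andbT.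
by apply/eqP => kb; apply: NPb; rewrite -kb.
Qed.

Lemma pmap_onth (T : Type) (w : seq T) m :
  (size w <= m)%N -> pmap (onth w) (iota 0 m) = w.
Proof.
elim: w m => [|x w IHw] [|m] //= lew; first by elim: (iota 1 m) => [|[]].
by congr cons; rewrite -{2}[w](IHw m) // (iotaDl 1 0 m); elim: (iota 0 m) => //= k s ->.
Qed.

Lemma convolution_fst (A : finType) (w1 w2 : seq A) :
  pmap fst (convolution w1 w2) = w1.
Proof.
rewrite -[RHS](@pmap_onth _ w1 (maxn (size w1) (size w2))) ?leq_maxl //.
by rewrite /convolution /mkseq; elim: (iota _ _) => //= k s ->.
Qed.

Lemma convolution_snd (A : finType) (w1 w2 : seq A) :
  pmap snd (convolution w1 w2) = w2.
Proof.
rewrite -[RHS](@pmap_onth _ w2 (maxn (size w1) (size w2))) ?leq_maxr //.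
by rewrite /convolution /mkseq; elim: (iota _ _) => //= k s ->.
Qed.

Lemma pmap_fst_size (A : finType) (c : seq (option A * option A)) :
  (size (pmap fst c) + count (fun p => p.1 == None) c)%N = size c.
Proof. by elim: c => //= -[[a|] b] c /= <-; rewrite ?addnS // add0n. Qed.

Lemma pmap_snd_size (A : finType) (c : seq (option A * option A)) :
  (size (pmap snd c) + count (fun p => p.2 == None) c)%N = size c.
Proof. by elim: c => //= -[b [a|]] c /= <-; rewrite ?addnS // add0n. Qed.

(* The pumping lemma, applied to the part of the word after position [m]. *)
Lemma dfa_pump (A : finType) (M : dfa A) (c : seq A) m :
  (m + #|dfa_state M| <= size c)%N -> dfa_accept M c ->
  exists u y v, [/\ c = u ++ y ++ v, (m <= size u)%N, (0 < size y)%N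
                  & dfa_accept M (u ++ y ++ y ++ v)].
Proof.
move=> lec acc.
pose f (i : 'I_(#|dfa_state M|).+1) := dfa_run (dfa_start M) (take (m + i) c).
have /injectivePn[i [j ij fij]] : ~~ injectiveb f.
  by apply/negP => /injectiveP/leq_card; rewrite card_ord ltnn.
wlog lt_ij : i j ij fij / (i < j)%N => [H|].
  have := ij; rewrite -val_eqE neq_ltn => /orP[|]; first exact: H.
  by apply: (H j i); rewrite // eq_sym.
have lej : (m + j <= size c)%N.
  by apply: leq_trans lec; rewrite leq_add2l -ltnS.
have Ej : take (m + j) c = take (m + i) c ++ take (j - i) (drop (m + i) c).
  by rewrite -takeD -addnA subnKC // ltnW.
have Ec : c = take (m + i) c ++ take (j - i) (drop (m + i) c) ++ drop (m + j) c.
  by rewrite catA -Ej cat_take_drop.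
rewrite {}/f Ej in fij.
exists (take (m + i) c), (take (j - i) (drop (m + i) c)), (drop (m + j) c).
have lei : (m + i <= size c)%N by apply: leq_trans lej; rewrite leq_add2l ltnW.
split=> //.
- by rewrite size_takel // leq_addr.
- rewrite size_takel ?subn_gt0 // size_drop leq_subRL //.
  by rewrite -addnA subnKC // ltnW.
move: acc; rewrite {1}Ec /dfa_accept /dfa_run !foldl_cat.
by move: fij; rewrite /dfa_run foldl_cat => E; rewrite -!E.
Qed.

Lemma padding_maximum (G : groupType) (S : seq G)
    (psi : cayley_automatic_rep S) (s : G) :
  s \in S -> exists d, is_maximum (padding_number psi s) d.
Proof.
case: psi => A L val_psi rep valK repK regL regM sS.
set psi := CayleyAutomaticRep _ _ _ _; have [M accM] := regM s sS.
apply: (@bounded_maximum _ #|dfa_state M| (paddings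
  (convolution (repr_word psi 1) (repr_word psi (1 * s))))).
  by exists 1.
move=> _ [g ->]; rewrite leqNgt; apply/negP.
set c := convolution _ _ => ltc.
have acc : dfa_accept M c.
  by apply/accM; exists (rep g), (rep (g * s)); rewrite !repK.
have c1 : pmap fst c = val (rep g) by apply: convolution_fst.
have c2 : pmap snd c = val (rep (g * s)) by apply: convolution_snd.
have no_pump u y v : c = u ++ y ++ v -> (0 < size y)%N ->
    dfa_accept M (u ++ y ++ y ++ v) ->
    pmap fst y = [::] \/ pmap snd y = [::] -> False.
  move=> Ec y_gt0 /accM[w1 [w2 [Ec' w12]]] Ey.
  have w1E := convolution_fst (val w1) (val w2).
  have w2E := convolution_snd (val w1) (val w2).
  suff : c = u ++ y ++ y ++ v.
    move/(congr1 size)/eqP; rewrite Ec !size_cat !eqn_add2l.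
    by rewrite -[X in X == _]add0n eqn_add2r eq_sym -leqn0 leqNgt y_gt0.
  rewrite Ec' /c; case: Ey => Ey.
    have {}w1E : w1 = rep g.
      by apply: val_inj; rewrite -w1E -Ec' -c1 Ec !pmap_cat Ey.
    have -> : w2 = rep (g * s) by apply: (can_inj valK); rewrite -w12 w1E !repK.
    by rewrite w1E.
  have {}w2E : w2 = rep (g * s).
    by apply: val_inj; rewrite -w2E -Ec' -c2 Ec !pmap_cat Ey.
  have -> : w1 = rep g.
    by apply: (can_inj valK); apply: (mulIg s); rewrite w12 w2E !repK.
  by rewrite w2E.
have sz1 := pmap_fst_size c; have sz2 := pmap_snd_size c.
have szc : size c = maxn (size (pmap fst c)) (size (pmap snd c)).
  by rewrite c1 c2 size_mkseq.
have cnth k : (k < size c)%N ->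
    nth (None, None) c k = (onth (val (rep g)) k, onth (val (rep (g * s))) k).
  by rewrite size_mkseq => ltk; rewrite nth_mkseq.
have pmap0 (p : option A * option A -> option A) u y v w :
    c = u ++ y ++ v -> (size w <= size u)%N ->
    (forall k, (k < size c)%N -> p (nth (None, None) c k) = onth w k) ->
    pmap p y = [::].
  move=> Ec lew pE; apply: size0nil; rewrite size_pmap; apply/eqP.
  rewrite -leqn0 leqNgt -has_count; apply/hasPn => z /(nthP (None, None))[k ltk <-].
  have ltc' : (size u + k < size c)%N.
    by rewrite Ec !size_cat ltn_add2l ltn_addr.
  move: (pE _ ltc'); rewrite Ec nth_cat ltnNge leq_addr /= addKn nth_cat ltk => ->.
  by rewrite onth_default //; apply: leq_trans lew (leq_addr _ _).
have [le12|lt21] := leqP (size (pmap fst c)) (size (pmap snd c)).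
  have [||u [y [v [Ec leu y_gt0 acc']]]] := @dfa_pump _ M c (size (pmap fst c)).
  - rewrite -[leqRHS]sz1 leq_add2l.
    move: ltc sz2; rewrite szc (maxn_idPr le12) /paddings => ltc /eqP.
    by rewrite -{2}[size _]addn0 eqn_add2l => /eqP E; rewrite E addn0 in ltc; apply: ltnW.
  - exact: acc.
  apply: (no_pump _ _ _ Ec y_gt0 acc'); left.
  apply: (pmap0 fst _ _ _ _ Ec leu) => k /cnth->; by rewrite c1.
have [||u [y [v [Ec leu y_gt0 acc']]]] := @dfa_pump _ M c (size (pmap snd c)).
- rewrite -[leqRHS]sz2 leq_add2l.
  move: ltc sz1; rewrite szc (maxn_idPl (ltnW lt21)) /paddings => ltc /eqP.
  by rewrite -{2}[size _]addn0 eqn_add2l => /eqP E; rewrite E add0n in ltc; apply: ltnW.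
- exact: acc.
apply: (no_pump _ _ _ Ec y_gt0 acc'); right.
apply: (pmap0 snd _ _ _ _ Ec leu) => k /cnth->; by rewrite c2.
Qed.

Section Wreath.
Variables A B : groupType.

Definition fsgroup : Type := {fsfun B -> A with 1}.

Definition fs_one : fsgroup := [fsfun].

Definition fs_mul (f f' : fsgroup) : fsgroup :=
  [fsfun x in finsupp f `|` finsupp f' => f x * f' x].

Definition fs_inv (f : fsgroup) : fsgroup :=
  [fsfun x in finsupp f => (f x)^-1].

(* The function written f^b, that is, x |-> f (b x). *)
Definition fs_shift (f : fsgroup) (b : B) : fsgroup :=
  [fsfun x in [fset b^-1 * y | y in finsupp f] => f (b * x)].

Definition fs_single (c : A) : fsgroup := [fsfun x in [fset 1] => c].

Definition wreath : Type := (fsgroup * B)%type.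
HB.instance Definition _ := Choice.on wreath.

Definition wreath_one : wreath := (fs_one, 1).
Definition wreath_mul (u v : wreath) : wreath :=
  (fs_mul u.1 (fs_shift v.1 (u.2)^-1), u.2 * v.2).
Definition wreath_inv (u : wreath) : wreath :=
  (fs_shift (fs_inv u.1) u.2, (u.2)^-1).

Lemma fs_oneE x : fs_one x = 1.
Proof. by rewrite /fs_one fsfunE. Qed.

Lemma fs_mulE f f' x : fs_mul f f' x = f x * f' x.
Proof.
rewrite /fs_mul fsfunE in_fsetU; case: (finsuppP f x) => //=.
by case: (finsuppP f' x); rewrite ?mulg1.
Qed.

Lemma fs_invE f x : fs_inv f x = (f x)^-1.
Proof. by rewrite /fs_inv fsfunE; case: finsuppP => //; rewrite invg1. Qed.

Lemma fs_shiftE f b x : fs_shift f b x = f (b * x).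
Proof.
rewrite /fs_shift fsfunE; case: ifPn => // xN.
rewrite fsfun_dflt //; apply: contraNN xN => bx.
by apply/imfsetP; exists (b * x) => //; rewrite mulKg.
Qed.

Lemma fs_singleE c x : fs_single c x = if x == 1 then c else 1.
Proof. by rewrite /fs_single fsfunE inE. Qed.

Lemma wreath_mulA : associative wreath_mul.
Proof.
move=> [f a] [g b] [h c]; congr pair; rewrite /= ?mulgA //.
by apply/fsfunP => x; rewrite !(fs_mulE, fs_shiftE) invgM !mulgA.
Qed.

Lemma wreath_mul1 : left_id wreath_one wreath_mul.
Proof.
move=> [f a]; congr pair; rewrite /= ?mul1g //.
by apply/fsfunP => x; rewrite !(fs_mulE, fs_shiftE, fs_oneE) invg1 !mul1g.
Qed.

Lemma wreath_mulr1 : right_id wreath_one wreath_mul.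
Proof.
move=> [f a]; congr pair; rewrite /= ?mulg1 //.
by apply/fsfunP => x; rewrite !(fs_mulE, fs_shiftE, fs_oneE) mulg1.
Qed.

Lemma wreath_mulV : left_inverse wreath_one wreath_inv wreath_mul.
Proof.
move=> [f a]; congr pair; rewrite /= ?mulVg //.
by apply/fsfunP => x; rewrite !(fs_mulE, fs_shiftE, fs_oneE, fs_invE) invgK mulVg.
Qed.

Lemma wreath_mulrV : right_inverse wreath_one wreath_inv wreath_mul.
Proof.
move=> [f a]; congr pair; rewrite /= ?mulgV //.
apply/fsfunP => x; rewrite !(fs_mulE, fs_shiftE, fs_oneE, fs_invE).
by rewrite mulVKg mulgV.
Qed.

HB.instance Definition _ := isGroup.Build wreath
  wreath_mulA wreath_mul1 wreath_mulr1 wreath_mulV wreath_mulrV.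


Definition wreath_base (c : A) : wreath := (fs_single c, 1).
Definition wreath_top (b : B) : wreath := (fs_one, b).

Definition wreath_gens (S : seq A) (T : seq B) : seq wreath :=
  [seq wreath_base s | s <- S] ++ [seq wreath_top t | t <- T].

Lemma wreath_baseM c c' :
  wreath_base (c * c') = wreath_base c * wreath_base c'.
Proof.
congr pair; rewrite /= ?mulg1 //; apply/fsfunP => x.
by rewrite fs_mulE fs_shiftE !fs_singleE invg1 mul1g; case: eqP; rewrite ?mulg1.
Qed.

Lemma wreath_topM b b' : wreath_top (b * b') = wreath_top b * wreath_top b'.
Proof.
congr pair; apply/fsfunP => x.
by rewrite fs_mulE fs_shiftE !fs_oneE mulg1.
Qed.

Lemma wreath_base1 : wreath_base 1 = 1.
Proof.
by congr pair; apply/fsfunP => x; rewrite fs_oneE fs_singleE if_same.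
Qed.

Lemma generates_morph (H : groupType) (S : seq H) (T : seq wreath)
    (phi : H -> wreath) :
  {morph phi : x y / x * y} -> phi 1 = 1 -> {in S, forall s, phi s \in T} ->
  generates S -> forall h, exists k, represents T k (phi h).
Proof.
move=> phiM phi1 phiS genS h; have [k /representsP[u [_ uS <-]]] := genS h.
elim: u uS {h k} => [|x u IHu] uS.
  by exists 0%N; rewrite big_nil phi1 represents1.
have [y yu|k ku] := IHu; first by apply: uS; rewrite inE yu orbT.
have xT : phi x \in symmetrize T.
  move: (uS x (mem_head _ _)); rewrite !mem_cat => /orP[/phiS->//|].
  case/mapP=> s /phiS sT ->; rewrite orbC (_ : phi _ = (phi s)^-1) ?map_f //.
  by apply: (mulgI (phi s)); rewrite -phiM !mulgV phi1.
by rewrite big_cons phiM; exists (1 + k)%N; apply/representsM/ku/represents_gen.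
Qed.

Lemma wreath_generates (S : seq A) (T : seq B) :
  generates S -> generates T -> generates (wreath_gens S T).
Proof.
move=> genS genT.
have gbase := @generates_morph _ _ (wreath_gens S T) _ wreath_baseM wreath_base1
  (fun s sS => eq_ind_r is_true
     (introT orP (or_introl (map_f wreath_base sS))) (mem_cat _ _ _)) genS.
have gtop := @generates_morph _ _ (wreath_gens S T) wreath_top wreath_topM erefl
  (fun t tT => eq_ind_r is_true
     (introT orP (or_intror (map_f wreath_top tT))) (mem_cat _ _ _)) genT.
have gM u v : (exists k, represents (wreath_gens S T) k u) ->
    (exists k, represents (wreath_gens S T) k v) ->
  exists k, represents (wreath_gens S T) k (u * v).
  by move=> [k ku] [l lv]; exists (k + l)%N; apply: representsM.
suff gfs (n : nat) (f : fsgroup) : (#|` finsupp f| <= n)%N ->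
    exists k, represents (wreath_gens S T) k ((f, 1) : wreath).
  case=> f b; have := gM _ _ (gfs _ f (leqnn _)) (gtop b).
  rewrite (_ : _ * _ = (f, b) :> wreath) //; congr pair; rewrite /= ?mul1g //.
  by apply/fsfunP => x; rewrite fs_mulE fs_shiftE fs_oneE mulg1.
elim: n f => [|n IHn] f.
  rewrite leqn0 cardfs_eq0 => /eqP f0; exists 0%N.
  suff -> : (f, 1) = 1 :> wreath by apply: represents1.
  by congr pair; apply/fsfunP => x; rewrite fs_oneE fsfun_dflt // f0 inE.
have [f0|[x xf] ltfn] := fset_0Vmem (finsupp f).
  by move=> _; apply: IHn; rewrite f0 cardfs0.
pose f' : fsgroup := [fsfun f with x |-> 1].
have {}IHn : exists k, represents (wreath_gens S T) k ((f', 1) : wreath).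
  apply: IHn; rewrite -ltnS; apply: leq_trans ltfn.
  rewrite [X in (_ < X)%N](cardfsD1 x) xf add1n ltnS; apply: fsubset_leq_card.
  by rewrite finsupp_with eqxx.
have := gM _ _ (gM _ _ (gM _ _ (gtop x) (gbase (f x))) (gtop x^-1)) IHn.
rewrite (_ : _ * _ = (f, 1) :> wreath) //; congr pair; rewrite /= ?mulg1 ?mulgV //.
apply/fsfunP => y; rewrite !(fs_mulE, fs_shiftE, fs_oneE, fs_singleE).
rewrite !(mulg1, mulgV, invg1, mul1g) fsfun_withE -(inj_eq (mulgI x)).
rewrite mulVKg mulg1.
by case: eqVneq => [->|_]; rewrite ?mulg1 ?mul1g.
Qed.

End Wreath.

(* Main.v *)
Require Import Defs.
From Stdlib Require Import ClassicalEpsilon.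
From mathcomp Require Import all_boot all_order all_algebra.
From mathcomp Require Import zify lra finmap.
Set Implicit Arguments.
Unset Strict Implicit.
Unset Printing Implicit Defensive.
Import Order.TTheory GRing.Theory Num.Theory.

(** Write an element of the wreath product as a configuration of lamps, with
values in [G], on the integers, together with a cursor; right multiplication by
[h] in [G] changes the lamp under the cursor, and right multiplication by a
generator of the integers moves the cursor by one step.  The element is read on
its window: the smallest interval that holds the lamps that are on, the origin
and the cursor.  Its code is the concatenation, over the window, of the words
[psiG^-1 (f i)], where the first letter of each of them also records whether
[i] is the origin and whether it is the cursor.  As no word of [psiG] is empty,
these marks cost no letter and separate the blocks, so the code is injective.

Regularity.  Lists of blocks have infinitely many possible entries, but only
finitely many types: is the lamp on, is this the origin, is this the cursor.
Being the window of some element depends on the list of types only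
([window_typesP]), and the blocks of a given type form a regular language, so
that the codes form a regular language by substitution ([regular_substitution]).
For a generator [s], the pairs formed by the codes of [g] and of [g * s] are
aligned block by block rather than letter by letter: a list of pairs of blocks,
each padded separately, is again obtained by a regular substitution.  Right
multiplication by [h] changes the block of the cursor; moving the cursor to the
right changes marks, may add the block of an unlit lamp at the right end and may
drop one at the left end ([window_shift]).  The length of the block of the cursor
changes by at most [d_j], and an unlit lamp has a block of length [K0]; so the
padding inside such a list is bounded, and an automaton with a bounded buffer
realigns the two tracks into a convolution ([regular_bounded_delay]).

Lengths.  The same block alignment shows that a generator changes the length of
the code by at most [K], and the code of the identity has length [K0]; this
gives (i).  For (ii), a tour goes from the origin to one end of the window, then
to the other end, lighting the lamps on the way, and comes back to the cursor;
choosing the first end on the side of the origin that is away from the cursor,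
the tour takes at most [2 (m - 1)] cursor moves when the window has [m] cells
([wlength_window]), and [m] is at most the length of the code. *)

(** * Regular languages through finitely many residuals *)

Section Regular.
Implicit Types A B S : finType.

Lemma dfa_run_cat A (M : dfa A) (q : dfa_state M) w u :
  dfa_run q (w ++ u) = dfa_run (dfa_run q w) u.
Proof. by rewrite /dfa_run foldl_cat. Qed.

Lemma eq_regular A (L L' : seq A -> Prop) :
  (forall w, L w <-> L' w) -> regular L -> regular L'.
Proof. by move=> LL' [M ML]; exists M => w; rewrite ML. Qed.

(** A Myhill-Nerode criterion.  The set of the [s] with [reach w s] plays the
    state after reading [w]: it determines the residual of [L] at [w], and there
    are finitely many such sets.  Since [reach] may quantify over decompositions
    of [w], this replaces the construction of nondeterministic automata. *)
Lemma regular_residuals A S (L : seq A -> Prop) (reach : seq A -> S -> Prop) :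
  (forall w w' u, (forall s, reach w s -> reach w' s) ->
     L (w ++ u) -> L (w' ++ u)) -> regular L.
Proof.
move=> resL; pose dec P : bool := excluded_middle_informative P.
have decP P : reflect P (dec P).
  by rewrite /dec; case: excluded_middle_informative => p; constructor.
pose f w : {set S} := [set s | dec (reach w s)].
have fL w w' u : f w = f w' -> L (w ++ u) -> L (w' ++ u).
  move=> fE; apply: resL => s /decP sw; apply/decP.
  by move/setP/(_ s): fE; rewrite !inE sw.
(* A word with the given state set; the automaton continues from it. *)
pose rep F := epsilon (inhabits [::]) (fun w => f w = F).
have repK w : f (rep (f w)) = f w.
  by apply: (epsilon_spec (inhabits [::]) (fun v => f v = f w)); exists w.
pose M := @DFA A {set S} (f [::]) [set F | dec (L (rep F))]
  (fun F x => f (rcons (rep F) x)).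
have run w : (forall z, L (rep (dfa_run (f [::] : dfa_state M) w) ++ z)
    <-> L (w ++ z)).
  elim/last_ind: w => [|w x IHw] z; first by split; apply: fL; rewrite repK.
  rewrite -cats1 dfa_run_cat /= -catA -IHw catA cats1.
  by split; apply: fL; rewrite repK.
exists M => w; rewrite /dfa_accept /= inE.
have := run w [::]; rewrite !cats0 => <-.
by split=> /decP.
Qed.

Lemma regular_invariant A S (L : seq A -> Prop) (f : seq A -> S) :
  (forall w w' u, f w = f w' -> L (w ++ u) -> L (w' ++ u)) -> regular L.
Proof.
move=> fL; apply: (@regular_residuals _ S _ (fun w s => f w = s)) => w w' u.
by move/(_ _ erefl)=> fE; apply: fL.
Qed.

Lemma regularI A (L L' : seq A -> Prop) :
  regular L -> regular L' -> regular (fun w => L w /\ L' w).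
Proof.
move=> [M ML] [M' ML']; apply: (@regular_invariant _ _ _
  (fun w => (dfa_run (dfa_start M) w, dfa_run (dfa_start M') w))) => w w' u [E E'].
by rewrite -!ML -!ML' /dfa_accept !dfa_run_cat E E'.
Qed.

Lemma regular_pmap A B (phi : A -> option B) (L : seq B -> Prop) :
  regular L -> regular (fun w => L (pmap phi w)).
Proof.
move=> [M ML]; apply: (@regular_invariant _ _ _
  (fun w => dfa_run (dfa_start M) (pmap phi w))) => w w' u E.
by rewrite -!ML /dfa_accept !pmap_cat !dfa_run_cat E.
Qed.

Lemma regular_map A B (phi : A -> B) (L : seq B -> Prop) :
  regular L -> regular (fun w => L (map phi w)).
Proof.
move/(regular_pmap (fun x => Some (phi x))); apply: eq_regular => w.
by rewrite (_ : pmap _ w = map phi w) //; elim: w => //= x w ->.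
Qed.

Lemma regular_singleton A (w0 : seq A) (b : bool) :
  regular (fun w => (w == w0) = b).
Proof.
apply: (@regular_invariant _ _ _ (fun w => insub w : option ((size w0).-bseq A))).
move=> w w' u; case: insubP => [v _ <-|ltw]; case: insubP => [v' _ <-|ltw'] //.
  by case=> ->.
have ne v : ~~ (size v <= size w0) -> (v ++ u == w0) = false.
  by move=> ltv; apply/eqP => E; move: ltv; rewrite -E size_cat leq_addr.
by rewrite !ne.
Qed.

Lemma regular_count1 A (p : pred A) : regular (fun w => count p w = 1).
Proof.
apply: (@regular_invariant _ _ _ (fun w => inord (minn (count p w) 2) : 'I_3)).
move=> w w' u /(congr1 (@nat_of_ord 3)); rewrite !inordK ?ltnS ?geq_minr // !count_cat; lia.
Qed.

Lemma regular_head A (x0 y : A) : regular (fun w => head x0 w != y).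
Proof.
apply: (@regular_invariant _ _ _ (fun w => (nilp w, head x0 w))).
by move=> [|x w] [|x' w'] u //= [->].
Qed.

Lemma regular_last A (x0 y : A) : regular (fun w => last x0 w != y).
Proof.
apply: (@regular_invariant _ _ _ (last x0)) => w w' u E.
by rewrite !last_cat E.
Qed.

Definition map_head (T U : Type) (phi0 phi : T -> U) (w : seq T) : seq U :=
  if w is x :: v then phi0 x :: map phi v else [::].

Lemma size_map_head (T U : Type) (phi0 phi : T -> U) w :
  size (map_head phi0 phi w) = size w.
Proof. by case: w => //= x w; rewrite size_map. Qed.

Lemma map_head_cat (T U : Type) (phi0 phi : T -> U) w u :
  map_head phi0 phi (w ++ u) =
  map_head phi0 phi w ++ (if nilp w then map_head phi0 phi u else map phi u).
Proof. by case: w => //= x w; rewrite map_cat. Qed.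

(** The state after [w] is that of an automaton for [L] on some preimage of
    [w]; whether [w] is empty decides which of the two letter maps comes next. *)
Lemma regular_map_head A B (phi0 phi : A -> B) (L : seq A -> Prop) :
  regular L -> regular (fun w => exists2 v, L v & map_head phi0 phi v = w).
Proof.
move=> [M ML]; apply: (@regular_residuals _ _ _ (fun w s =>
  exists2 v, map_head phi0 phi v = w & s = (nilp v, dfa_run (dfa_start M) v))).
move=> w w' u sub [v /ML accv Ev].
pose v1 := take (size w) v; pose v2 := drop (size w) v.
have Ev12 : v = v1 ++ v2 by rewrite cat_take_drop.
have sz1 : size (map_head phi0 phi v1) = size w.
  by rewrite size_map_head size_takel // -(size_map_head phi0 phi) Ev size_cat leq_addr.
move: Ev; rewrite Ev12 map_head_cat => /eqP; rewrite eqseq_cat //.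
case/andP=> /eqP Ew /eqP Eu.
have [v1' Ew' [nilE runE]] := sub _ (ex_intro2 _ _ v1 Ew erefl).
exists (v1' ++ v2); last by rewrite map_head_cat Ew' -nilE Eu.
by apply/ML; rewrite /dfa_accept dfa_run_cat -runE -dfa_run_cat -Ev12.
Qed.

(** The cut between [w] and [u] falls inside the block of [x], or at its left
    end; this fails at the right end of the whole list, whence [u <> [::]]. *)
Lemma flatten_split (T X : Type) (omega : X -> seq T) xs w u :
  u <> [::] -> flatten (map omega xs) = w ++ u ->
  exists xs1 x xs2 r r', [/\ xs = xs1 ++ x :: xs2,
    w = flatten (map omega xs1) ++ r, omega x = r ++ r'
    & u = r' ++ flatten (map omega xs2)].
Proof.
move=> u0; elim: xs w => [|x xs IHxs] w /=; first by case: w => // /esym/u0.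
move=> E; have [ltw|lew] := ltnP (size w) (size (omega x)).
  have Ew : w = take (size w) (omega x).
    by have := congr1 (take (size w)) E; rewrite [RHS]take_size_cat // takel_cat 1?ltnW.
  exists [::], x, xs, w, (drop (size w) (omega x)); split=> //.
    by rewrite {1}Ew cat_take_drop.
  by have := congr1 (drop (size w)) E; rewrite [RHS]drop_size_cat // drop_cat ltw.
have Ew : w = omega x ++ drop (size (omega x)) w.
  rewrite -{1}(cat_take_drop (size (omega x)) w); congr (_ ++ _).
  by have := congr1 (take (size (omega x))) E; rewrite [LHS]take_size_cat // takel_cat.
have [|xs1 [y [xs2 [r [r' [-> E1 E2 E3]]]]]] := IHxs (drop (size (omega x)) w).
  move: E; rewrite {1}Ew -catA => /(congr1 (drop (size (omega x)))).
  by rewrite !drop_size_cat.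
by exists (x :: xs1), y, xs2, r, r'; split=> //=; rewrite -catA -E1.
Qed.

(** The list [xs] ranges over an infinite alphabet [X], seen through its finitely
    many types.  A state after a prefix [w] consists of the state of [P] after the
    types of the complete blocks, the type of the block being read, and the state
    of the automaton of that type. *)
Lemma regular_substitution A S (X : Type) (tau : X -> S) (omega : X -> seq A)
    (P : seq S -> Prop) :
  regular P ->
  (forall t, regular (fun w => exists2 x, tau x = t & omega x = w)) ->
  regular (fun w => exists2 xs, P (map tau xs) & flatten (map omega xs) = w).
Proof.
move=> [MP accP] /fin_all_exists[M accM].
set L := fun w => _.
(* The extra state [None] records whether [w] itself is in the language,
   the only case in which no block follows. *)
pose reach w (s : option (dfa_state MP * {t : S & dfa_state (M t)})) :=
  if s is Some (p, q) then
    exists xs r, [/\ w = flatten (map omega xs) ++ r,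
       dfa_run (dfa_start MP) (map tau xs) = p
     & dfa_run (dfa_start (M (tag q))) r = tagged q]
  else L w.
apply: (@regular_residuals _ _ _ reach) => w w' u sub.
have [->|/eqP u0] := eqVneq u [::]; first by rewrite !cats0; apply: (sub None).
case=> xs /accP Pxs /(flatten_split u0)[xs1 [x [xs2 [r [r' [Exs Ew Ex Eu]]]]]].
have [] := sub (Some (dfa_run (dfa_start MP) (map tau xs1),
  Tagged (fun t => dfa_state (M t)) (dfa_run (dfa_start (M (tau x))) r))).
  by exists xs1, r.
move=> ys [s [-> runP /= runM]].
have [|y Ey Eys] := (iffLR (accM (tau x) (s ++ r'))).
  rewrite /dfa_accept dfa_run_cat runM -dfa_run_cat -Ex.
  by apply/accM; exists x.
exists (ys ++ y :: xs2); last by rewrite map_cat flatten_cat /= Eys Eu !catA.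
apply/accP; move: Pxs; rewrite /dfa_accept Exs !map_cat !dfa_run_cat runP /=.
by rewrite Ey.
Qed.

End Regular.

(** * Padded words and convolutions *)

Section Convolution.
Implicit Types A B : finType.

Lemma convolutionE A (w1 w2 : seq A) : ~~ (nilp w1 && nilp w2) ->
  convolution w1 w2
  = (ohead w1, ohead w2) :: convolution (behead w1) (behead w2).
Proof.
move=> nn; have Em : maxn (size w1) (size w2)
    = (maxn (size (behead w1)) (size (behead w2))).+1.
  by case: w1 w2 nn => [|x w1] [|y w2] //= _; lia.
rewrite /convolution Em /mkseq /=; congr cons.
rewrite -[1]/(1 + 0) (iotaDl 1 0) -map_comp; apply: eq_map => k /=.
by rewrite add0n; case: w1 w2 {nn Em} => [|? ?] [|? ?] /=; case: k => [|k].
Qed.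

Lemma convolution_diag A (w : seq A) :
  convolution w w = [seq (Some x, Some x) | x <- w].
Proof. by elim: w => //= x w <-; rewrite convolutionE. Qed.

Lemma convolution_nilr A (w : seq A) :
  convolution w [::] = [seq (Some x, None) | x <- w].
Proof. by elim: w => //= x w <-; rewrite convolutionE. Qed.

Lemma convolution_nill A (w : seq A) :
  convolution [::] w = [seq (None, Some x) | x <- w].
Proof. by elim: w => //= x w <-; rewrite convolutionE. Qed.

Definition omap2 (T U : Type) (f g : T -> U) (p : option T * option T) :=
  (omap f p.1, omap g p.2).

Lemma convolution_map A B (f g : A -> B) w1 w2 :
  convolution (map f w1) (map g w2) = map (omap2 f g) (convolution w1 w2).
Proof.
elim: w1 w2 => [|x w1 IHw] [|y w2] //.
- by rewrite !convolution_nill -!map_comp.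
- by rewrite !convolution_nilr -!map_comp.
by rewrite [in RHS]convolutionE //= [LHS]convolutionE //= IHw.
Qed.

Lemma convolution_map_head A B (f0 f g0 g : A -> B) w1 w2 :
  convolution (map_head f0 f w1) (map_head g0 g w2)
  = map_head (omap2 f0 g0) (omap2 f g) (convolution w1 w2).
Proof.
have [/andP[/nilP-> /nilP->] //|nn] := boolP (nilp w1 && nilp w2).
rewrite [in RHS]convolutionE //= -convolution_map convolutionE.
  by case: w1 w2 nn => [|x w1] [|y w2].
by case: w1 w2 nn => [|x w1] [|y w2].
Qed.

Definition padded (T : Type) (p : option T * option T) : bool * bool :=
  (~~ isSome p.1, ~~ isSome p.2).

(** A padded track stays padded, and at most one track is padded: the local rule
    that singles out convolutions among the words of pairs. *)
Definition sync_rel (p q : bool * bool) :=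
  [&& p.1 ==> q.1, p.2 ==> q.2 & ~~ (q.1 && q.2)].

(** The pair [e] tells which tracks have already ended. *)
Lemma sync_convolution_from A (e : bool * bool) (w1 w2 : seq A) :
  (e.1 -> w1 = [::]) -> (e.2 -> w2 = [::]) ->
  path sync_rel e (map (@padded A) (convolution w1 w2)).
Proof.
elim: w1 w2 e => [|x w1 IHw] w2 [e1 e2] /= E1 E2.
  rewrite convolution_nill -map_comp; case: e2 E2 => [/(_ erefl)->//|_].
  by elim: w2 {E1} e1 => //= y w2 IHw e1; rewrite {1}/sync_rel /= implybT; apply: IHw.
case: w2 E2 => [|y w2] E2.
  rewrite convolution_nilr -map_comp; case: e1 E1 => [/(_ erefl)//|_].
  elim: (x :: w1) {E2} e2 => //= y w2 IHw' e2.
  by rewrite {1}/sync_rel /= implybT; apply: IHw'.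
case: e1 E1 => [/(_ erefl)//|_]; case: e2 E2 => [/(_ erefl)//|_].
by rewrite convolutionE //=; apply: IHw.
Qed.

Lemma convolution_sync_from A (e : bool * bool) (c : seq (option A * option A)) :
  path sync_rel e (map (@padded A) c) ->
  [/\ e.1 -> pmap fst c = [::], e.2 -> pmap snd c = [::]
    & c = convolution (pmap fst c) (pmap snd c)].
Proof.
elim: c e => [|[x y] c IHc] [e1 e2] //= /andP[/and3P[/= xe ye xy]].
case/IHc=> /= E1 E2 Ec; case: x y xe ye xy E1 E2 Ec => [x|] [y|] //=.
- case: e1 e2 => [] [] // _ _ _ _ _ Ec; split=> //.
  by rewrite convolutionE //= -Ec.
- case: e1 => // _ _ _ _ /(_ isT) E2 Ec; split=> //.
  by rewrite E2 in Ec *; rewrite convolutionE //= -Ec.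
case: e2 => // _ _ _ /(_ isT) E1 _ Ec.
by split=> //; rewrite E1 in Ec *; rewrite convolutionE //= -Ec.
Qed.

Definition synchronous A (c : seq (option A * option A)) :=
  path sync_rel (false, false) (map (@padded A) c).

Lemma synchronousP A (c : seq (option A * option A)) :
  reflect (c = convolution (pmap fst c) (pmap snd c)) (synchronous c).
Proof.
apply: (iffP idP) => [/convolution_sync_from[]//|->].
exact: sync_convolution_from.
Qed.

Lemma synchronous_cat A (c u : seq (option A * option A)) :
  synchronous (c ++ u) = synchronous c &&
    path sync_rel (last (false, false) (map (@padded A) c)) (map (@padded A) u).
Proof. by rewrite /synchronous map_cat cat_path. Qed.

Lemma paddings_cat A (c u : seq (option A * option A)) :
  paddings (c ++ u) = paddings c + paddings u.
Proof. by rewrite /paddings !count_cat; lia. Qed.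

Lemma pmap_prefix (A B : finType) (phi : A -> option B) m p v k :
  pmap phi m = p ++ v -> size (pmap phi (take k m)) <= size p ->
  exists2 r, pmap phi (take k m) ++ r = p & pmap phi (drop k m) = r ++ v.
Proof.
move=> E le; move: E; rewrite -{1}(cat_take_drop k m) pmap_cat => E.
have E1 := congr1 (take (size p)) E; have E2 := congr1 (drop (size (pmap phi (take k m)))) E.
move: E1 E2; rewrite [take _ (p ++ _)]take_size_cat // take_cat ltnNge le /=.
rewrite drop_size_cat // => E1 E2.
exists (take (size p - size (pmap phi (take k m))) (pmap phi (drop k m))) => //.
rewrite -{1}(cat_take_drop (size p - size (pmap phi (take k m))) (pmap phi (drop k m))).
congr (_ ++ _); rewrite E2 drop_drop subnK //.
by rewrite drop_size_cat.
Qed.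

Lemma size_pmap_fst_ge A (c : seq (option A * option A)) :
  size c <= size (pmap fst c) + paddings c.
Proof. by rewrite -{1}(pmap_fst_size c) /paddings; lia. Qed.

Lemma size_pmap_snd_ge A (c : seq (option A * option A)) :
  size c <= size (pmap snd c) + paddings c.
Proof. by rewrite -{1}(pmap_snd_size c) /paddings; lia. Qed.

(** A track that has not ended after [c] has one letter at each position of [c]. *)
Lemma sync_last A e (c : seq (option A * option A)) :
  path sync_rel e (map (@padded A) c) ->
  let e' := last e (map (@padded A) c) in
  [/\ e.1 -> e'.1, e'.1 \/ size (pmap fst c) = size c,
      e.2 -> e'.2 & e'.2 \/ size (pmap snd c) = size c].
Proof.
elim: c e => [|[x y] c IHc] e /=; first by split=> //; right.
case/andP=> /and3P[/= ex ey _] /IHc[mono1 full1 mono2 full2].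
split=> [e1||e2|].
- by apply: mono1; move: ex; rewrite e1.
- case: full1 => full; first by left.
  case: x mono1 {ex full2 mono2} => [x|] mono1 /=; last by left; apply: mono1.
  by right; rewrite full.
- by apply: mono2; move: ey; rewrite e2.
case: full2 => full; first by left.
case: y mono2 {ey full1 mono1} => [y|] mono2 /=; last by left; apply: mono2.
by right; rewrite full.
Qed.

(** A word [m] of pairs with padding at arbitrary places is read as an
    alignment of its two tracks.  Having read the convolution up to [c], one keeps
    the state of the automaton of [M] on some [m1], together with what each track
    of [c] holds beyond that of [m1].  Taking for [m1] the prefix of [m] that is
    as long as [c] bounds both remainders by the padding of [m1], hence by [d]. *)
Lemma regular_bounded_delay A (M : seq (option A * option A) -> Prop) d :
  regular M -> (forall m, M m -> paddings m <= d) ->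
  regular (fun c => exists2 m, M m & c = convolution (pmap fst m) (pmap snd m)).
Proof.
move=> [D accD] padM; set L := fun c => _.
have LP c : L c <-> synchronous c /\
    exists2 m, M m & pmap fst m = pmap fst c /\ pmap snd m = pmap snd c.
  split=> [[m Mm ->]|[/synchronousP Ec [m Mm [E1 E2]]]].
    rewrite convolution_fst convolution_snd; split; last by exists m.
    exact: sync_convolution_from.
  by exists m; rewrite ?E1 ?E2.
pose flag (c : seq (option A * option A)) := last (false, false) (map (@padded A) c).
pose reach (c : seq (option A * option A))
    (s : dfa_state D * d.-bseq A * d.-bseq A * (bool * bool)) :=
  [/\ synchronous c, flag c = s.2
    & exists m, [/\ dfa_run (dfa_start D) m = s.1.1.1,
         pmap fst m ++ s.1.1.2 = pmap fst c & pmap snd m ++ s.1.2 = pmap snd c]].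
apply: (@regular_residuals _ _ _ reach) => c c' u sub.
case/LP; rewrite synchronous_cat => /andP[sync_c sync_u] [m Mm [E1 E2]].
have pad := padM _ Mm.
pose m1 := take (size c) m; pose m2 := drop (size c) m.
have Em : m = m1 ++ m2 by rewrite cat_take_drop.
have buffer (phi : option A * option A -> option A) :
    (forall w, size w <= size (pmap phi w) + paddings w) ->
    pmap phi u = [::] \/ size (pmap phi c) = size c ->
    pmap phi m = pmap phi (c ++ u) -> exists r : d.-bseq A,
      pmap phi m1 ++ r = pmap phi c /\ pmap phi m2 = r ++ pmap phi u.
  move=> ge full; rewrite pmap_cat => E.
  have [|r Er Er'] := @pmap_prefix _ _ phi m (pmap phi c) (pmap phi u) (size c) E.
    (* Either the track ended within [c], and then it contains all of [m], or it
       has as many letters as [c]. *)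
    case: full => [u0|->]; last first.
      rewrite size_pmap; apply: leq_trans (count_size _ _) _.
      by rewrite size_take; case: ltnP.
    by move: E; rewrite u0 cats0 => <-; rewrite -/m1 Em pmap_cat size_cat leq_addr.
  have ltr : size r <= d.
    have [lec|lec] := leqP (size c) (size m).
      have le_c : size (pmap phi c) <= size m1.
        rewrite [size m1]size_takel // size_pmap; exact: count_size.
      rewrite -(leq_add2l (size (pmap phi m1))) -size_cat Er.
      apply: leq_trans le_c (leq_trans (ge m1) _).
      rewrite leq_add2l; apply: leq_trans pad.
      by rewrite Em paddings_cat leq_addr.
    by move: Er'; rewrite drop_oversize ?(ltnW lec) //; case: (r).
  by exists (Bseq ltr).
have [u1 u2 _] := convolution_sync_from sync_u.
have [_ full1 _ full2] := sync_last sync_c.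
have [|r1 [Er1 Er1']] := buffer fst (@size_pmap_fst_ge A) _ E1.
  by case: full1 => [/u1|]; [left|right].
have [|r2 [Er2 Er2']] := buffer snd (@size_pmap_snd_ge A) _ E2.
  by case: full2 => [/u2|]; [left|right].
have [|sync_c' Ef [m1' [/= run1 Em1 Em2]]] :=
  sub (dfa_run (dfa_start D) m1, r1, r2, flag c).
  by split=> //; exists m1.
apply/LP; split; first by rewrite synchronous_cat sync_c' -/(flag c') Ef.
exists (m1' ++ m2).
  by apply/accD; rewrite /dfa_accept dfa_run_cat run1 -dfa_run_cat -Em; apply/accD.
by rewrite !pmap_cat Er1' Er2' !catA Em1 Em2.
Qed.

End Convolution.

Section ConvolutionSizes.
Variable A : finType.
Implicit Types w : seq A.

Definition swap (p : option A * option A) := (p.2, p.1).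

Lemma convolution_swap w1 w2 : map swap (convolution w1 w2) = convolution w2 w1.
Proof. by rewrite /convolution maxnC /mkseq -map_comp. Qed.

Lemma paddings_convolution w1 w2 :
  paddings (convolution w1 w2) = (size w1 - size w2) + (size w2 - size w1).
Proof.
have := pmap_fst_size (convolution w1 w2).
have := pmap_snd_size (convolution w1 w2).
rewrite convolution_fst convolution_snd size_mkseq /paddings; lia.
Qed.

Lemma flatten_fst (X : Type) (u v : X -> seq A) xs :
  pmap fst (flatten [seq convolution (u x) (v x) | x <- xs]) = flatten (map u xs).
Proof. by elim: xs => //= x xs IHxs; rewrite pmap_cat IHxs convolution_fst. Qed.

Lemma flatten_snd (X : Type) (u v : X -> seq A) xs :
  pmap snd (flatten [seq convolution (u x) (v x) | x <- xs]) = flatten (map v xs).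
Proof. by elim: xs => //= x xs IHxs; rewrite pmap_cat IHxs convolution_snd. Qed.

Lemma size_snd_le (m : seq (option A * option A)) :
  size (pmap snd m) <= size (pmap fst m) + paddings m.
Proof.
apply: leq_trans (size_pmap_fst_ge m).
by rewrite size_pmap; apply: count_size.
Qed.

Lemma size_fst_le (m : seq (option A * option A)) :
  size (pmap fst m) <= size (pmap snd m) + paddings m.
Proof.
apply: leq_trans (size_pmap_snd_ge m).
by rewrite size_pmap; apply: count_size.
Qed.

Lemma map_head_map (T U V : Type) (f0 f : U -> V) (h : T -> U) v :
  map_head f0 f (map h v) = map_head (f0 \o h) (f \o h) v.
Proof. by case: v => //= x v; rewrite -map_comp. Qed.

End ConvolutionSizes.

Local Open Scope ring_scope.

(** * Lists of cells that describe an element of the wreath product *)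

(** Indexing by all the integers, so that windows can be translated freely. *)
Definition nthz (T : Type) (x0 : T) (s : seq T) (x : int) : T :=
  if x is Posz n then nth x0 s n else x0.

Section Nthz.
Variables (T : Type) (x0 : T).
Implicit Types (s : seq T) (x : int).

Lemma nthz_neg s x : x < 0 -> nthz x0 s x = x0.
Proof. by case: x. Qed.

Lemma nthz_over s x : (size s)%:Z <= x -> nthz x0 s x = x0.
Proof. by case: x => [n|n] //; rewrite lez_nat => le_n; apply: nth_default. Qed.

Lemma nthz_nil x : nthz x0 [::] x = x0.
Proof. by case: x => [n|n] //=; rewrite nth_nil. Qed.

Lemma nthz_cons y s x : nthz x0 (y :: s) x = if x == 0 then y else nthz x0 s (x - 1).
Proof.
have [x_lt0|] := ltP x 0.
  by rewrite !nthz_neg; [case: eqP => [x0'|//]; lia | lia | lia].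
case: x => [[|n]|n] // _; rewrite (_ : n.+1%:Z - 1 = n) //; lia.
Qed.

Lemma nthz_rcons_default s x : nthz x0 (rcons s x0) x = nthz x0 s x.
Proof.
case: x => [n|n] //=; rewrite nth_rcons; case: ltnP => // les.
by rewrite nth_default // if_same.
Qed.

Lemma nthz_cons_default s x : nthz x0 (x0 :: s) x = nthz x0 s (x - 1).
Proof. by rewrite nthz_cons; case: eqP => [->|]. Qed.

Lemma nthz_rev s x : nthz x0 (rev s) x = nthz x0 s ((size s)%:Z - 1 - x).
Proof.
have [x_ge0|x_lt0] := leP 0 x; last first.
  by rewrite nthz_neg // nthz_over //; lia.
have [x_ge|x_lt] := leP (size s)%:Z x.
  by rewrite nthz_over ?size_rev // nthz_neg //; lia.
case: x x_ge0 x_lt => [n|n] // _; rewrite ltz_nat => lt_n.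
rewrite (_ : _ - _ - _ = (size s - n.+1)%N%:Z :> int); last by lia.
by rewrite /= nth_rev.
Qed.

End Nthz.

Lemma nthz_map (T U : Type) (f : T -> U) (x0 : T) s x :
  nthz (f x0) (map f s) x = f (nthz x0 s x).
Proof.
case: x => [n|n] //=; have [lt|ge] := ltnP n (size s); first exact: nth_map.
by rewrite !nth_default ?size_map.
Qed.

Section Count1.
Variables (T : Type) (p : pred T) (x0 : T).
Hypothesis px0 : ~~ p x0.

Lemma count1_nthz (s : seq T) (x : int) :
  count p s = 1%N -> p (nthz x0 s x) = (x == find p s).
Proof.
case: x => [n|n] /= cs; last by rewrite (negbTE px0).
rewrite eqz_nat; elim: s n cs => [|y s IHs] [|n] //=.
  by case: (p y) => //= _; rewrite (negbTE px0).
case: ifP => [py|_] /=; last by rewrite eqSS; apply: IHs.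
rewrite add1n => -[/eqP]; rewrite eqn0Ngt -has_count -all_predC.
move/(all_nthP x0) => np.
have [lt|ge] := ltnP n (size s); first exact/negbTE/np.
by rewrite nth_default // (negbTE px0).
Qed.

Lemma nthz_count1 (s : seq T) (k : nat) :
  (forall x : int, p (nthz x0 s x) = (x == k)) -> count p s = 1%N.
Proof.
elim: s k => [|y s IHs] [|k] E.
- by have := E 0; rewrite /= (negbTE px0).
- by have := E k.+1; rewrite /= (negbTE px0) eqxx.
- rewrite /= (_ : p y = true); last exact: (E 0).
  rewrite (_ : count p s = 0%N) //; apply/eqP.
  rewrite eqn0Ngt -has_count -all_predC; apply/(all_nthP x0) => i _ /=.
  by rewrite (E i.+1).
rewrite /= (_ : p y = false); last exact: (E 0).
apply: (IHs k) => -[n|n] /=; last by rewrite (negbTE px0).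
by rewrite (E n.+1) !eqz_nat eqSS.
Qed.
End Count1.

Section Windows.
Variable G : groupType.
Implicit Types (g : wreath G intZ).

Definition cell : Type := (G * bool * bool)%type.
Implicit Types (b : cell) (s : seq cell).

Definition lamp b : G := b.1.1.
Definition is_origin b : bool := b.1.2.
Definition is_cursor b : bool := b.2.
Definition blank : cell := (1%g, false, false).

Definition entry g (x : int) : cell := (g.1 x, x == 0, x == g.2).

(** The list [s] covers an interval outside of which the line of [g] is blank;
    [k] is the index of the origin in [s]. *)
Definition encodes g s :=
  exists k : nat, forall x : int, nthz blank s (x + k%:Z) = entry g x.

Definition trimmed s := (head blank s != blank) && (last blank s != blank).

(** The mark of the origin fixes the translation. *)
Lemma encodes_inj g h s : encodes g s -> encodes h s -> g = h.
Proof.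
move=> [k Ek] [l El].
have kl : k = l.
  have := Ek (l%:Z - k%:Z); rewrite subrK -{1}[l%:Z]add0r El => /(congr1 is_origin).
  by rewrite /is_origin /= eqxx => /esym; rewrite subr_eq0 => /eqP[].
subst l; have E x : entry g x = entry h x by rewrite -Ek El.
case: g h E {Ek El} => [f z] [f' z'] E; congr pair.
  by apply/fsfunP => x; have [] := E x.
by have := congr1 is_cursor (E z); rewrite /is_cursor /= eqxx => /esym/eqP.
Qed.

(** A trimmed list starts as far to the right as possible. *)
Lemma encodes_offset_le g s t (k l : nat) :
  trimmed t -> (forall x : int, nthz blank s (x + k%:Z) = entry g x) ->
  (forall x : int, nthz blank t (x + l%:Z) = entry g x) -> (l <= k)%N.
Proof.
move=> /andP[hd _] Ek El; rewrite leqNgt; apply: contra hd => ltkl.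
have := El (- l%:Z); rewrite addrC subrr -Ek [RHS]nthz_neg; last by lia.
by rewrite -nth0 /= => ->.
Qed.

Lemma encodes_size_le s t :
  trimmed t -> nth blank s =1 nth blank t -> (size t <= size s)%N.
Proof.
case: t => // b t /andP[_ la] E; rewrite leqNgt; apply: contra la => lt.
by rewrite -nth_last -E nth_default //= -ltnS.
Qed.

Lemma encodes_unique g s t :
  encodes g s -> encodes g t -> trimmed s -> trimmed t -> s = t.
Proof.
move=> [k Ek] [l El] ts tt.
have kl : k = l.
  by apply/eqP; rewrite eqn_leq (encodes_offset_le ts El Ek) (encodes_offset_le tt Ek El).
subst l; have E n : nth blank s n = nth blank t n.
  by have := Ek (n%:Z - k%:Z); rewrite -El subrK.
apply: (@eq_from_nth _ blank) => [|i _]; last exact: E.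
by apply/eqP; rewrite eqn_leq !encodes_size_le //; move=> n; rewrite E.
Qed.

Lemma encodes_cons_blank g s : encodes g (blank :: s) -> encodes g s.
Proof.
move=> [[|k] Ek].
  by have := Ek 0; rewrite /= => /(congr1 is_origin).
exists k => x; rewrite -Ek nthz_cons_default; congr nthz; lia.
Qed.

Lemma encodes_rcons_blank g s : encodes g (rcons s blank) <-> encodes g s.
Proof. by split=> -[k Ek]; exists k => x; rewrite -Ek nthz_rcons_default. Qed.

Lemma encodes_trim g s : encodes g s -> exists2 t, encodes g t & trimmed t.
Proof.
have [n] := ubnP (size s); elim: n s => // n IHn s /ltnSE le_n enc.
have [ts|] := boolP (trimmed s); first by exists s.
rewrite negb_and !negbK; case: s le_n enc => [|b s] le_n enc.
  by case: enc => k /(_ 0); rewrite /nthz /= nth_nil => /(congr1 is_origin).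
case/orP=> [/eqP/= Eb|/eqP]; first by apply: (IHn s) => //; apply: encodes_cons_blank; rewrite -Eb.
move: le_n enc; rewrite lastI last_rcons size_rcons => le_n enc Eb.
by apply: (IHn (belast b s)) => //; apply/encodes_rcons_blank; rewrite -Eb.
Qed.

Lemma encodes_exists g : exists s, encodes g s.
Proof.
pose N := (\max_(x <- finsupp g.1) `|x : int|%N + `|g.2 : int|%N)%N.
have out x : N%:Z < `|x| -> entry g x = blank.
  move=> ltx; congr (_, _, _).
  - rewrite fsfun_dflt //; apply/negP => xg.
    have leN : (`|x| <= N)%N.
      apply: leq_trans (leq_addr _ _).
      exact: (@leq_bigmax_seq intZ (enum_fset (finsupp g.1)) predT (fun y : intZ => `|y : int|%N)).
    by move: ltx leN; clearbody N; lia.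
  - by apply/eqP; lia.
  - apply/eqP => E; move: ltx; rewrite E /N; lia.
exists (mkseq (fun i => entry g (i%:Z - N%:Z)) (N + N).+1), N => x.
have [lt|le] := leP (x + N%:Z) (-1).
  by rewrite nthz_neg ?out //; lia.
have [lt'|ge] := leP (x + N%:Z) (N + N)%N%:Z; last first.
  by rewrite nthz_over ?out ?size_mkseq //; lia.
have [n En] : exists n : nat, x + N%:Z = n by exists `|(x + N%:Z)%R|%N; lia.
by rewrite En /= nth_mkseq ?ltnS; [congr entry; lia | lia].
Qed.

End Windows.

(** * Generators and windows in coordinates *)

Section Generators.
Variable G : groupType.
Implicit Types (g u v : wreath G intZ) (b : cell G) (s : seq (cell G)).

Definition shift (n : int) : wreath G intZ := @wreath_top G intZ n.
Definition light (h : G) : wreath G intZ := @wreath_base G intZ h.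

Lemma wreathM1 u v (x : int) : ((u * v)%g.1 x = u.1 x * v.1 (x - (u.2 : int)))%g.
Proof. by rewrite fs_mulE fs_shiftE addrC. Qed.

Lemma wreathM2 u v : (u * v)%g.2 = (u.2 : int) + (v.2 : int) :> int.
Proof. by []. Qed.

Lemma shift1 n x : (shift n).1 x = 1%g.
Proof. exact: fs_oneE. Qed.

Lemma light1 h (x : int) : (light h).1 x = if x == 0 then h else 1%g.
Proof. exact: fs_singleE. Qed.

Lemma wreath_eqP u v :
  (forall x : int, u.1 x = v.1 x) -> u.2 = v.2 :> int -> u = v.
Proof. by case: u v => [f z] [f' z'] /= E ->; congr pair; apply/fsfunP. Qed.

Lemma shiftD m n : shift (m + n) = (shift m * shift n)%g.
Proof. exact: wreath_topM. Qed.

(** The way to set a whole interval of lamps: from left to right when [e = 1],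
    from right to left when [e = -1]. *)
Definition sweep (e : int) (hs : seq G) : wreath G intZ :=
  (\prod_(h <- hs) (shift e * light h))%g.

Lemma sweep_cons e h hs : sweep e (h :: hs) = (shift e * light h * sweep e hs)%g.
Proof. by rewrite /sweep big_cons. Qed.

Lemma sweep2 e hs : (sweep e hs).2 = e * (size hs)%:Z :> int.
Proof.
elim: hs => [|h hs IHhs]; first by rewrite /sweep big_nil mulr0.
rewrite sweep_cons wreathM2 IHhs /= -[(size hs).+1]add1n PoszD mulrDr mulr1.
by congr (_ + _); rewrite [LHS]addr0.
Qed.

Lemma sweep1 e hs (x : int) : e * e = 1 ->
  (sweep e hs).1 x = nthz 1%g hs (e * x - 1).
Proof.
move=> ee; elim: hs x => [|h hs IHhs] x.
  by rewrite /sweep big_nil fs_oneE nthz_nil.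
rewrite sweep_cons !wreathM1 shift1 light1 mul1g nthz_cons.
rewrite (_ : (shift e * light h)%g.2 = e :> int); last exact: addr0.
rewrite IHhs mulrBr ee (_ : (x - e == 0) = (e * x - 1 == 0)).
  case: eqP => [E|_]; last by rewrite mul1g.
  by rewrite E nthz_neg ?mulg1.
rewrite !subr_eq0; apply/eqP/eqP => [->//|E].
by rewrite -[LHS]mul1r -ee -mulrA E mulr1.
Qed.

(** The cursor goes to the left end of the window, one step further because
    [sweep] moves before it lights, sweeps to the right end, and returns to its
    final position. *)
Lemma sweep_rightE g s (k : nat) :
  (forall x : int, nthz (blank G) s (x + k%:Z) = entry g x) ->
  g = (shift (- k%:Z - 1) * sweep 1 (map (@lamp G) s)
       * shift ((g.2 : int) + k%:Z - (size s)%:Z + 1))%g.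
Proof.
move=> Ek; apply: wreath_eqP => [x|].
  rewrite !wreathM1 !shift1 mul1g mulg1 sweep1 // mul1r.
  rewrite (_ : x - (- k%:Z - 1) - 1 = x + k%:Z); last by lia.
  by rewrite (nthz_map _ (blank G)) Ek.
by rewrite !wreathM2 sweep2 size_map /=; lia.
Qed.

Lemma sweep_leftE g s (k : nat) :
  (forall x : int, nthz (blank G) s (x + k%:Z) = entry g x) ->
  g = (shift ((size s)%:Z - k%:Z) * sweep (-1) (rev (map (@lamp G) s))
       * shift ((g.2 : int) + k%:Z))%g.
Proof.
move=> Ek; apply: wreath_eqP => [x|].
  rewrite !wreathM1 !shift1 mul1g mulg1 sweep1 // nthz_rev size_map.
  rewrite (_ : _ - 1 - (_ - 1) = x + k%:Z); last by rewrite /=; lia.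
  by rewrite (nthz_map _ (blank G)) Ek.
by rewrite !wreathM2 sweep2 size_rev size_map /=; lia.
Qed.

Definition one_origin_cursor s :=
  (count (@is_origin G) s = 1)%N /\ (count (@is_cursor G) s = 1)%N.

Lemma encodes_counts g s : encodes g s -> one_origin_cursor s.
Proof.
move=> [k Ek]; have E x : nthz (blank G) s x = entry g (x - k%:Z).
  by rewrite -Ek subrK.
split; first by apply: (@nthz_count1 _ (@is_origin G) (blank G) isT _ k) => x; rewrite E /is_origin /=; lia.
have ge0 : 0 <= (g.2 : int) + k%:Z.
  rewrite leNgt; apply/negP => lt0; have := E ((g.2 : int) + k%:Z).
  rewrite nthz_neg // addrK => /(congr1 (@is_cursor G)).
  by rewrite /is_cursor /= eqxx.
apply: (@nthz_count1 _ (@is_cursor G) (blank G) isT _ `|((g.2 : int) + k%:Z)%R|%N) => x.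
by rewrite gez0_abs // E /is_cursor /= subr_eq.
Qed.

(** The element is read off the list by performing the sweep that it
    prescribes. *)
Lemma counts_encodes s : one_origin_cursor s -> exists g, encodes g s.
Proof.
move=> [origin1 cursor1].
pose k := find (@is_origin G) s; pose l := find (@is_cursor G) s.
exists (shift (- k%:Z - 1) * sweep 1 (map (@lamp G) s)
       * shift (l%:Z - (size s)%:Z + 1))%g.
exists k => x; rewrite /entry !wreathM1 !shift1 mul1g mulg1 sweep1 // mul1r.
rewrite !wreathM2 sweep2 size_map (_ : _ - _ - 1 = x + k%:Z); last by rewrite /=; lia.
rewrite (nthz_map _ (blank G)).
have := @count1_nthz _ (@is_origin G) (blank G) isT _ (x + k%:Z) origin1.
have := @count1_nthz _ (@is_cursor G) (blank G) isT _ (x + k%:Z) cursor1.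
case: (nthz _ _ _) => [[h o] c]; rewrite /is_cursor /is_origin /lamp /= => -> ->.
by rewrite -/k -/l; congr (_, _, _); lia.
Qed.

(** The list exists and is unique (see [encodes_trim] and [encodes_unique]). *)
Definition window g : seq (cell G) :=
  epsilon (inhabits [::]) (fun s => encodes g s /\ trimmed s).

Lemma windowP g : encodes g (window g) /\ trimmed (window g).
Proof.
apply: (epsilon_spec (inhabits [::]) (fun s => encodes g s /\ trimmed s)).
by have [s /encodes_trim[t]] := encodes_exists g; exists t.
Qed.

Lemma window_eq g s : encodes g s -> trimmed s -> window g = s.
Proof. by have [enc tr] := windowP g => /(encodes_unique enc); apply. Qed.

Lemma window_inj : injective window.
Proof.
move=> g h E; have [enc_g _] := windowP g; have [enc_h _] := windowP h.
by apply: encodes_inj enc_g _; rewrite E.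
Qed.

Lemma window1 : window 1%g = [:: (1%g, true, true)].
Proof.
apply: window_eq; last by rewrite /trimmed /= !xpair_eqE !andbF.
exists 0%N => x; rewrite addr0 /entry fs_oneE.
rewrite nthz_cons nthz_nil -[X in x == X]/(0 : int).
by case: eqP.
Qed.

Definition relamp (h : G) b : cell G :=
  if is_cursor b then ((lamp b * h)%g, is_origin b, true) else b.

Lemma relamp_blank h b : (relamp h b == blank G) = (b == blank G).
Proof. by case: b => [[h' o] []]; rewrite /relamp //= !xpair_eqE !andbF. Qed.

Lemma trimmed_map s (f : cell G -> cell G) :
  (forall b, (f b == blank G) = (b == blank G)) -> trimmed (map f s) = trimmed s.
Proof.
move=> fE; have f0 : f (blank G) = blank G by apply/eqP; rewrite fE.
rewrite /trimmed -{1 3}f0 last_map -!nth0 !fE.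
by case: s => [|b s] /=; rewrite ?f0 // !fE.
Qed.

Lemma window_light g h : window (g * light h)%g = map (relamp h) (window g).
Proof.
have [[k Ek] tr] := windowP g; apply: window_eq; last first.
  by rewrite trimmed_map // => b; apply: relamp_blank.
exists k => x; have rb : relamp h (blank G) = blank G by [].
have E2 : (g * light h)%g.2 = g.2 :> int := addr0 (g.2 : int).
rewrite -{1}rb nthz_map Ek /entry wreathM1 light1 E2 subr_eq0 /relamp /is_cursor /=.
by case: (x == g.2); rewrite ?mulg1.
Qed.

End Generators.

(** * Moving the cursor *)

Section Slide.
Variable G : groupType.
Implicit Types (g : wreath G intZ) (b : cell G) (s : seq (cell G)).

(** A cell before a move of the cursor, with its cursor mark after the move, and
    a flag: [None] if the cell belongs to the windows before and after the move,
    [Some true] if only to the first one, [Some false] if only to the second. *)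
Definition slide_cell : Type := (cell G * (bool * option bool))%type.
Implicit Types (x : slide_cell) (xs : seq slide_cell).

Definition with_cursor (c : bool) b : cell G := (lamp b, is_origin b, c).

Definition old_cell x : option (cell G) :=
  if x.2.2 != Some false then Some x.1 else None.
Definition new_cell x : option (cell G) :=
  if x.2.2 != Some true then Some (with_cursor x.2.1 x.1) else None.

(** Reading the window from left to right, the cursor mark of a cell after the
    move is that of its left neighbour before the move, which [c] carries; a cursor
    that leaves the window on the right adds a cell. *)
Fixpoint slide_from (c : bool) s : seq slide_cell :=
  if s is b :: s' then (b, (c, None)) :: slide_from (is_cursor b) s'
  else if c then [:: (blank G, (true, Some false))] else [::].

(** Only the first cell can leave the window: this happens when it held
    nothing but the cursor. *)
Definition slide s : seq slide_cell :=
  if s is b :: s' then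
    (b, (false, if with_cursor false b == blank G then Some true else None))
      :: slide_from (is_cursor b) s'
  else [::].

Lemma with_cursor_true b : with_cursor true b != blank G.
Proof. by rewrite !xpair_eqE !andbF. Qed.

Lemma with_cursorK b : with_cursor (is_cursor b) b = b.
Proof. by case: b => [[]]. Qed.

Lemma old_slide_from c s : pmap old_cell (slide_from c s) = s.
Proof. by elim: s c => [|b s IHs] [] //=; rewrite IHs. Qed.

Lemma old_slide s : pmap old_cell (slide s) = s.
Proof. by case: s => [|b s] //=; case: ifP => _; rewrite /= old_slide_from. Qed.

(** The cell after the move, whether or not the window still contains it. *)
Definition full_cell x : cell G := with_cursor x.2.1 x.1.

Lemma new_slide_from c s :
  pmap new_cell (slide_from c s) = map full_cell (slide_from c s).
Proof. by elim: s c => [|b s IHs] [] //=; rewrite IHs. Qed.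

Lemma nthz_slide_from c s (y : int) :
  nthz (blank G) (map full_cell (slide_from c s)) y =
  with_cursor (if y == 0 then c else is_cursor (nthz (blank G) s (y - 1)))
    (nthz (blank G) s y).
Proof.
elim: s c y => [|b s IHs] c y /=.
  by rewrite !nthz_nil; case: c; rewrite /= ?nthz_cons nthz_nil; case: eqP.
rewrite !nthz_cons IHs; case: eqP => // _; by case: eqP.
Qed.

Lemma encodes_slide g s :
  encodes g s -> encodes (g * shift G 1)%g (map full_cell (slide s)).
Proof.
move=> [k Ek]; exists k => x.
have -> : map full_cell (slide s) = map full_cell (slide_from false s).
  by case: (s).
rewrite nthz_slide_from Ek.
have -> : (if x + k%:Z == 0 then false
    else is_cursor (nthz (blank G) s (x + k%:Z - 1))) = is_cursor (entry g (x - 1)).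
  rewrite -Ek addrAC; case: eqP => // E; rewrite nthz_neg //; lia.
rewrite /entry /with_cursor /is_cursor /lamp /is_origin wreathM1 shift1 mulg1.
by rewrite wreathM2 /= subr_eq.
Qed.

(** If the cursor leaves the last cell of [s], then it stands on the last cell
    of the slide; otherwise the last cell of [s] has another reason to be there. *)
Lemma last_slide_from c s b :
  (if s is [::] then c || (b != blank G) else last (blank G) s != blank G) ->
  last b (map full_cell (slide_from c s)) != blank G.
Proof.
elim: s c b => [|b' s IHs] c b /=.
  by case: c => //= _; apply: with_cursor_true.
move=> la; apply: IHs; case: s la => //= nb.
case cb: (is_cursor b') => //=; apply: contra nb => /eqP[l0 o0 _].
by rewrite -[b']with_cursorK cb /with_cursor l0 o0.
Qed.

Lemma encodes_new_slide g s :
  encodes g s -> encodes (g * shift G 1)%g (pmap new_cell (slide s)).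
Proof.
move/encodes_slide; case: s => [|b s] //=; rewrite /full_cell /= -/full_cell.
by case: eqP => [->|_] /=; rewrite new_slide_from // => /encodes_cons_blank.
Qed.

Lemma trimmed_new_slide s : trimmed s -> trimmed (pmap new_cell (slide s)).
Proof.
case: s => [|b s] /andP[/= hd la]; first by rewrite eqxx in hd.
have la' : (if s is [::] then is_cursor b || (with_cursor false b != blank G)
    else last (blank G) s != blank G) : bool.
  case: s la => //= _; case cb: (is_cursor b) => //=.
  by rewrite -cb with_cursorK.
case: ifP => [/eqP Eb|Eb] /=; rewrite new_slide_from; last first.
  by apply/andP; split; [rewrite [head _ _]/= Eb | apply: last_slide_from].
(* The dropped cell held the cursor, which is now on the next cell. *)
have cb : is_cursor b.
  by apply: contraR hd => /negbTE cb; rewrite -Eb -cb with_cursorK.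
apply/andP; split; last by apply: last_slide_from; case: (s) la'; rewrite ?cb.
by rewrite cb; case: (s) => [|b' s'] /=; apply: with_cursor_true.
Qed.

Lemma window_shift g :
  window (g * shift G 1)%g = pmap new_cell (slide (window g)).
Proof.
have [enc tr] := windowP g; apply: window_eq; first exact: encodes_new_slide.
exact: trimmed_new_slide.
Qed.

Definition cell_type : finType := (bool * bool * bool)%type.
Definition slide_type : finType := (cell_type * (bool * option bool))%type.

Definition type_of b : cell_type := (lamp b == 1%g, is_origin b, is_cursor b).
Definition slide_type_of x : slide_type := (type_of x.1, x.2).

Definition blank_type : cell_type := (true, false, false).

Lemma type_of_blank b : (type_of b == blank_type) = (b == blank G).
Proof. by case: b => [[h o] c]; rewrite !xpair_eqE eqb_id. Qed.

(** What distinguishes windows among lists of cells can be seen on types, see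
    [window_typesP]. *)
Definition window_types (ts : seq cell_type) : Prop :=
  ((head blank_type ts != blank_type) /\ (last blank_type ts != blank_type)) /\
  (count (fun t : cell_type => t.1.2) ts = 1%N /\ count (fun t : cell_type => t.2) ts = 1%N).

Lemma regular_window_types : regular window_types.
Proof.
do 2 apply: regularI.
- exact: regular_head.
- exact: regular_last.
- exact: regular_count1.
exact: regular_count1.
Qed.

Lemma window_typesP s : window_types (map type_of s) <-> exists g, s = window g.
Proof.
have E : window_types (map type_of s) <-> trimmed s /\ one_origin_cursor s.
  rewrite /window_types /trimmed /one_origin_cursor !count_map.
  have -> : blank_type = type_of (blank G) by rewrite /type_of /lamp eqxx.
  have -> : head (type_of (blank G)) (map type_of s) = type_of (head (blank G) s).
    by case: (s).
  rewrite last_map -[type_of (blank G)]/(_ : cell_type).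
  have tb b : (type_of b == type_of (blank G)) = (b == blank G).
    by rewrite -type_of_blank /type_of /lamp eqxx.
  by rewrite !tb; split=> [[[-> ->]]|[/andP[]]].
rewrite E; split=> [[tr /counts_encodes[g enc]]|[g ->]].
  by exists g; rewrite (window_eq enc tr).
have [enc tr] := windowP g; split=> //; exact: encodes_counts enc.
Qed.

(** The state records a rejection ([None]), the start, the end of a slide (no
    letter may follow), or the cursor mark of the last cell before the move. *)
Definition slide_state : finType := option (option (option bool)).
Definition st_start : slide_state := Some None.
Definition st_end : slide_state := Some (Some None).
Definition st_in (c : bool) : slide_state := Some (Some (Some c)).

Definition slide_step (q : slide_state) (t : slide_type) : slide_state :=
  let: (e, o, c, (c', keep)) := t in
  match q with
  | Some None =>
      if ~~ c' && (keep == if e && ~~ o then Some true else None)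
      then st_in c else None
  | Some (Some (Some c0)) =>
      match keep with
      | None => if c' == c0 then st_in c else None
      | Some false => if [&& c0, c', e, ~~ o & ~~ c] then st_end else None
      | Some true => None
      end
  | _ => None
  end.

Definition slide_dfa : dfa slide_type :=
  DFA st_start [set q | (q == st_end) || (q == st_in false)] slide_step.

Definition slide_acc (q : slide_state) ts :=
  dfa_run (q : dfa_state slide_dfa) ts \in dfa_final slide_dfa.

Lemma slide_acc_cons q t ts : slide_acc q (t :: ts) = slide_acc (slide_step q t) ts.
Proof. by []. Qed.

Lemma slide_acc_dead ts : slide_acc None ts = false.
Proof.
elim: ts => [|t ts IHts]; first by rewrite /slide_acc inE.
by rewrite slide_acc_cons; move: t => [[[e o] c] [c' keep]].
Qed.

Lemma slide_acc_end ts : slide_acc st_end ts = nilp ts.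
Proof.
case: ts => [|t ts]; first by rewrite /slide_acc inE.
by rewrite slide_acc_cons; move: t => [[[e o] c] [c' keep]]; apply: slide_acc_dead.
Qed.

(** An unlit lamp is determined by its type, so that the types determine
    whether a list is a slide. *)
Lemma slide_acc_from c xs :
  slide_acc (st_in c) (map slide_type_of xs) <-> xs = slide_from c (pmap old_cell xs).
Proof.
elim: xs c => [|[b [c' keep]] xs IHxs] c.
  by rewrite /slide_acc inE; case: c.
rewrite [map _ _]/= slide_acc_cons /=; case: keep => [[]|] /=.
- rewrite slide_acc_dead; split=> // -[]//.
- case: c => /=; last first.
    rewrite slide_acc_dead; split=> //.
    by case: (pmap _ _) => //.
  have [/and4P[c'T e0 o0 c0]|cond] := boolP [&& _, _, _ & _].
    rewrite slide_acc_end; have Eb : b = blank G.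
      by apply/eqP; rewrite -type_of_blank !xpair_eqE e0 (negbTE o0) (negbTE c0).
    rewrite Eb c'T; split=> [/nilP|]; first by case: (xs).
    by case: (pmap _ _) => //= -[->].
  rewrite slide_acc_dead; split=> //; case: (pmap _ _) => //= -[Eb Ec _].
  by move: cond; rewrite Eb Ec /lamp /= eqxx.
case: eqP => [->|ne].
  by rewrite IHxs; split=> [<-|[]].
by rewrite slide_acc_dead; split=> // -[].
Qed.

Lemma slide_accP xs :
  slide_acc st_start (map slide_type_of xs) <->
  xs = slide (pmap old_cell xs) /\ xs <> [::].
Proof.
case: xs => [|[b [c' keep]] xs]; first by rewrite /slide_acc !inE; split=> // -[].
rewrite [map _ _]/= slide_acc_cons /=.
have -> : (lamp b == 1%g) && ~~ is_origin b = (with_cursor false b == blank G).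
  by rewrite !xpair_eqE andbT eqbF_neg.
set keep0 := if with_cursor _ _ == _ then _ else _.
have keep0F : keep0 != Some false by rewrite /keep0; case: ifP.
case: ifP => [/andP[/negbTE-> /eqP->]|cond].
  rewrite slide_acc_from /old_cell keep0F /= -/keep0.
  by split=> [<-//|[[]]].
rewrite slide_acc_dead; split=> // -[E _]; move: E cond.
by case: (oapp _ _ _) => //= b' s [Eb -> -> _]; rewrite /keep0 Eb eqxx.
Qed.
End Slide.

(** * The code of an element and its regular relations *)

Local Open Scope nat_scope.

Section Code.
Variables (G : groupType) (gs : seq G) (psiG : cayley_automatic_rep gs).
Implicit Types (g : wreath G intZ) (b : cell G) (s : seq (cell G)) (h : G).

Let A := car_symbol psiG.
Let rep h : seq A := repr_word psiG h.
Let K0 := size (rep 1%g).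

Definition symbol : finType := (A * option (bool * bool))%type.

Definition tag_head (o c : bool) (x : A) : symbol := (x, Some (o, c)).
Definition tag_tail (x : A) : symbol := (x, None).

Definition tag (o c : bool) : seq A -> seq symbol := map_head (tag_head o c) tag_tail.

Definition block b : seq symbol := tag (is_origin b) (is_cursor b) (rep (lamp b)).
Definition word s : seq symbol := flatten (map block s).
Definition code g : seq symbol := word (window g).

Lemma size_block b : size (block b) = size (rep (lamp b)).
Proof. exact: size_map_head. Qed.

Lemma rep_inj : injective rep.
Proof. by move=> h h' /val_inj/(can_inj (@car_repK _ _ psiG)). Qed.

Lemma rep_lang h : car_lang psiG (rep h).
Proof. exact: (valP (car_rep psiG h)). Qed.

Section NonemptyWords.
Hypothesis nil_psiG : ~~ car_lang psiG [::].

Lemma rep_neq0 h : rep h <> [::].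
Proof. by move=> E; have := rep_lang h; rewrite E (negbTE nil_psiG). Qed.

Lemma size_rep_gt0 h : 0 < size (rep h).
Proof. by have := @rep_neq0 h; case: (rep h). Qed.

(** The first letter of every block is marked and the other ones are not. *)
Lemma tail_cat_inj v v' s s' :
  map tag_tail v ++ word s = map tag_tail v' ++ word s' -> v = v' /\ word s = word s'.
Proof.
have head_word x w t : word t = tag_tail x :: w -> False.
  case: t => // b t; rewrite /word /= /block /tag.
  by have := @rep_neq0 (lamp b); case: (rep (lamp b)).
elim: v v' => [|x v IHv] [|x' v'] //=.
- by move/head_word.
- by move/esym/head_word.
by case=> -> /IHv[-> ->].
Qed.

Lemma word_inj : injective word.
Proof.
elim=> [|b s IHs] [|b' s'] //.
- rewrite /word /= /block /tag; have := @rep_neq0 (lamp b').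
  by case: (rep (lamp b')).
- rewrite /word /= /block /tag; have := @rep_neq0 (lamp b).
  by case: (rep (lamp b)).
rewrite /word /= -!/(word _) /block /tag.
have := @rep_inj (lamp b) (lamp b').
have := @rep_neq0 (lamp b); have := @rep_neq0 (lamp b').
case: (rep (lamp b)) => // x v; case: (rep (lamp b')) => // x' v' _ _ inj /=.
case=> Ex Eo Ec /tail_cat_inj[Ev /IHs->].
move: inj; rewrite Ex Ev => /(_ erefl) El; congr cons.
move: El Eo Ec; rewrite /lamp /is_origin /is_cursor.
by case: b b' => [[h o] c] [[h' o'] c'] /= -> -> ->.
Qed.

Lemma code_inj : injective code.
Proof. by move=> g g' /word_inj/window_inj. Qed.

End NonemptyWords.

(** The representatives of the lamps of one type; the one that is off has a
    single representative. *)
Lemma regular_rep (e : bool) :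
  regular (fun v => exists2 h, (h == 1%g) = e & rep h = v).
Proof.
apply: eq_regular (regularI (car_lang_regular psiG) (@regular_singleton _ (rep 1%g) e)).
move=> v; split=> [[vL <-]|[h <- <-]]; last by rewrite rep_lang (inj_eq rep_inj).
exists (car_val psiG (Sub v vL)); last by rewrite /rep /repr_word car_valK SubK.
by rewrite -(inj_eq rep_inj) /rep /repr_word car_valK SubK.
Qed.

Lemma regular_rep_map_head (B : finType) (phi0 phi : A -> B) e :
  regular (fun w => exists2 h, (h == 1%g) = e & map_head phi0 phi (rep h) = w).
Proof.
apply: eq_regular (regular_map_head phi0 phi (regular_rep e)) => w.
by split=> [[_ [h <- <-] <-]|[h <- <-]]; [exists h | exists (rep h) => //; exists h].
Qed.

Lemma regular_code : regular (fun w => exists g, w = code g).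
Proof.
have fibre t : regular (fun w => exists2 b, type_of b = t & block b = w).
  case: t => [[e o] c].
  apply: eq_regular (regular_rep_map_head (tag_head o c) tag_tail e) => w.
  split=> [[h <- <-]|[[[h o'] c'] [<- <- <-] <-]]; last by exists h.
  by exists (h, o, c).
apply: eq_regular (regular_substitution regular_window_types fibre) => w.
split=> [[s /window_typesP[g ->] <-]|[g ->]]; first by exists g.
by exists (window g) => //; apply/window_typesP; exists g.
Qed.

Section Lamp.
Variables (h0 : G) (d : nat).
Hypothesis h0_gs : h0 \in gs.
Hypothesis d_max : forall h, paddings (convolution (rep h) (rep (h * h0)%g)) <= d.

(** The blocks of a cell before and after multiplication by [h0], padded
    separately, so that the next cells of both windows start together. *)
Definition relamp_pair b := convolution (block b) (block (relamp h0 b)).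

Lemma paddings_relamp s :
  paddings (flatten (map relamp_pair s)) <= d * count (@is_cursor G) s.
Proof.
elim: s => [|b s IHs]; first by rewrite /paddings.
rewrite /= paddings_cat mulnDr leq_add //.
rewrite /relamp_pair paddings_convolution !size_block /relamp.
case: ifP => _; last by rewrite subnn.
by rewrite muln1 -paddings_convolution; apply: d_max.
Qed.

(** Only the block of the cursor is padded, and there is one cursor. *)
Lemma paddings_relamp_window g :
  paddings (flatten (map relamp_pair (window g))) <= d.
Proof.
have [enc _] := windowP g; have [_ c1] := encodes_counts enc.
by have := paddings_relamp (window g); rewrite c1 muln1.
Qed.

Lemma fst_relamp g : pmap fst (flatten (map relamp_pair (window g))) = code g.
Proof. exact: flatten_fst. Qed.

Lemma snd_relamp g :
  pmap snd (flatten (map relamp_pair (window g))) = code (g * light h0)%g.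
Proof. by rewrite /relamp_pair flatten_snd /code window_light /word -map_comp. Qed.

Lemma size_code_light g :
  size (code (g * light h0)%g) <= size (code g) + d /\
  size (code g) <= size (code (g * light h0)%g) + d.
Proof.
rewrite -snd_relamp -fst_relamp.
have pad := paddings_relamp_window g.
split; [apply: leq_trans (size_snd_le _) _ | apply: leq_trans (size_fst_le _) _];
  by rewrite leq_add2l.
Qed.

Lemma regular_rep_mul (e : bool) :
  regular (fun c => exists2 h, (h == 1%g) = e & c = convolution (rep h) (rep (h * h0)%g)).
Proof.
have mulR := @car_mul_regular _ _ psiG _ h0_gs.
have fstR := @regular_pmap _ _ (@fst (option A) (option A)) _ (regular_rep e).
apply: eq_regular (regularI mulR fstR) => c.
 split=> [[[w1 [w2 [-> E]]] [h eh Eh]]|[h eh ->]].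
  have E1 : car_val psiG w1 = h.
    apply: rep_inj; rewrite Eh /rep /repr_word car_valK.
    exact/esym/convolution_fst.
  exists h => //; rewrite -E1 E /rep /repr_word !car_valK.
  by [].
split; last by exists h; rewrite ?convolution_fst.
by exists (car_rep psiG h), (car_rep psiG (h * h0)%g); rewrite !car_repK.
Qed.

Lemma regular_code_light :
  regular (fun c => exists g, c = convolution (code g) (code (g * light h0)%g)).
Proof.
have fibre t : regular (fun w => exists2 b, type_of b = t & relamp_pair b = w).
  case: t => [[e o] []].
    apply: eq_regular (regular_map_head (omap2 (tag_head o true) (tag_head o true))
      (omap2 tag_tail tag_tail) (regular_rep_mul e)) => w.
    split=> [[_ [h eh ->] <-]|[[[h o'] c'] [eh <- Ec] <-]].
      by exists (h, o, true); rewrite ?/type_of ?eh // -convolution_map_head.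
    rewrite /is_cursor /= in Ec; rewrite {}Ec.
    exists (convolution (rep h) (rep (h * h0)%g)); first by exists h.
    by rewrite -convolution_map_head.
  apply: eq_regular (regular_rep_map_head
    (fun x => (Some (tag_head o false x), Some (tag_head o false x)))
    (fun x => (Some (tag_tail x), Some (tag_tail x))) e) => w.
  have diag h o' : map_head (fun x => (Some (tag_head o' false x), Some (tag_head o' false x)))
    (fun x => (Some (tag_tail x), Some (tag_tail x))) (rep h)
    = relamp_pair (h, o', false).
    rewrite /relamp_pair /relamp convolution_diag /block /tag.
    by case: (rep _) => //= x v; rewrite -map_comp.
  split=> [[h eh <-]|[[[h o'] c'] [eh <- Ec] <-]].
    by exists (h, o, false); rewrite ?/type_of ?eh ?diag.
  by rewrite /is_cursor /= in Ec; subst c'; exists h => //; apply: diag.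
have := regular_substitution regular_window_types fibre.
move/(@regular_bounded_delay _ _ d) => reg.
apply: eq_regular (reg _) => [c|m [s /window_typesP[g ->] <-]]; last first.
  exact: paddings_relamp_window.
split=> [[m [s /window_typesP[g ->] <-] ->]|[g ->]].
  by exists g; rewrite fst_relamp snd_relamp.
exists (flatten (map relamp_pair (window g))); last by rewrite fst_relamp snd_relamp.
by exists (window g) => //; apply/window_typesP; exists g.
Qed.

End Lamp.

Definition oblock (o : option (cell G)) := if o is Some b then block b else [::].

(** The blocks of a cell before and after the move; a cell missing from one of
    the windows is padded entirely. *)
Definition slide_pair (x : slide_cell G) :=
  convolution (oblock (old_cell x)) (oblock (new_cell x)).

Lemma flatten_oblock (X : Type) (f : X -> option (cell G)) xs :
  flatten (map (fun x => oblock (f x)) xs) = word (pmap f xs).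
Proof. by elim: xs => //= x xs ->; case: (f x). Qed.

Lemma fst_slide g : pmap fst (flatten (map slide_pair (slide (window g)))) = code g.
Proof. by rewrite flatten_fst flatten_oblock old_slide. Qed.

Lemma snd_slide g :
  pmap snd (flatten (map slide_pair (slide (window g)))) = code (g * shift G 1)%g.
Proof. by rewrite flatten_snd flatten_oblock /code window_shift. Qed.

Lemma size_new_block (c : bool) b : size (block (with_cursor c b)) = size (block b).
Proof. by rewrite !size_block. Qed.

Lemma size_block_blank (c : bool) b : with_cursor c b == blank G -> size (block b) = K0.
Proof. by rewrite size_block => /eqP[-> _ _]. Qed.

Lemma paddings_slide_pair c b : paddings (slide_pair (b, (c, None))) = 0.
Proof.
have E : size (oblock (new_cell (b, (c, None)))) = size (oblock (old_cell (b, (c, None)))).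
  exact: size_new_block.
by rewrite paddings_convolution E subnn.
Qed.

Lemma paddings_slide_from c s :
  paddings (flatten (map slide_pair (slide_from c s))) <= K0.
Proof.
elim: s c => [|b s IHs] [] //=; rewrite paddings_cat.
- by rewrite paddings_convolution /= sub0n subn0 size_block addn0.
- by rewrite paddings_slide_pair IHs.
- by rewrite paddings_slide_pair IHs.
Qed.

(** A padded block represents an unlit lamp, and only the two end cells of the
    slide can be padded. *)
Lemma paddings_slide s : paddings (flatten (map slide_pair (slide s))) <= K0 + K0.
Proof.
case: s => // b s; rewrite /= paddings_cat leq_add ?paddings_slide_from //.
case: ifP => [Eb|_]; last by rewrite paddings_slide_pair.
by rewrite paddings_convolution /= subn0 sub0n addn0 (size_block_blank Eb).
Qed.

Lemma size_word_cons b s : size (word (b :: s)) = size (block b) + size (word s).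
Proof. by rewrite /word /= size_cat. Qed.

Lemma size_slide_from c s :
  size (word s) <= size (word (pmap (@new_cell G) (slide_from c s)))
    <= size (word s) + K0.
Proof.
elim: s c => [|b s IHs] c.
  by case: c => //=; rewrite size_word_cons size_block addn0 leqnn.
by rewrite /= !size_word_cons size_new_block -addnA !leq_add2l.
Qed.

(** When both end cells of the slide are padded, the two changes of length
    cancel, so that [K0] suffices here although the padding may be [K0 + K0]. *)
Lemma size_code_shift g :
  size (code (g * shift G 1)%g) <= size (code g) + K0 /\
  size (code g) <= size (code (g * shift G 1)%g) + K0.
Proof.
rewrite /code window_shift; case: (window g) => // b s.
have /andP[] := size_slide_from (is_cursor b) s.
rewrite /= !size_word_cons; case: ifP => [Eb|_] /=.
  by rewrite (size_block_blank Eb); lia.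
rewrite size_word_cons (size_new_block false b) -!addnA !leq_add2l => le1 le2.
by split=> //; apply: leq_trans le1 (leq_addr _ _).
Qed.

Definition pairing (keep : option bool) (x : A) : option A * option A :=
  (if keep != Some false then Some x else None,
   if keep != Some true then Some x else None).

(** In all the cases of a slide, both tracks are images of one representative:
    this makes the pairs of a given type a regular language. *)
Lemma slide_pairE h o c c' keep :
  slide_pair (h, o, c, (c', keep)) =
  map_head (omap2 (tag_head o c) (tag_head o c') \o pairing keep)
           (omap2 tag_tail tag_tail \o pairing keep) (rep h).
Proof.
rewrite -map_head_map /slide_pair.
case: keep => [[]|] /=.
- by rewrite -[[::]]/(tag o c' [::]) convolution_map_head convolution_nilr.
- by rewrite -[[::]]/(tag o c [::]) convolution_map_head convolution_nill.
by rewrite convolution_map_head convolution_diag.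
Qed.

Definition old_type (t : slide_type) : option cell_type :=
  if t.2.2 != Some false then Some t.1 else None.

Lemma old_types xs :
  pmap old_type (map (@slide_type_of G) xs) = map (@type_of G) (pmap (@old_cell G) xs).
Proof.
elim: xs => //= x xs ->; rewrite /old_type /old_cell /=.
by case: ifP.
Qed.

Lemma regular_slide_acc : regular (fun ts => slide_acc st_start ts).
Proof. by exists slide_dfa => ts. Qed.

Lemma slide_typesP xs :
  (window_types (pmap old_type (map (@slide_type_of G) xs)) /\
   slide_acc st_start (map (@slide_type_of G) xs)) <->
  exists g, xs = slide (window g).
Proof.
rewrite old_types window_typesP slide_accP; split.
  by move=> [[g E] [Exs _]]; exists g; rewrite Exs E.
move=> [g ->]; rewrite old_slide; split; first by exists g.
split=> //; have [_] := windowP g; case: (window g) => [|b s] //.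
by rewrite /trimmed eqxx.
Qed.

Lemma regular_code_shift :
  regular (fun c => exists g, c = convolution (code g) (code (g * shift G 1)%g)).
Proof.
have fibre t : regular (fun w => exists2 x, slide_type_of x = t & slide_pair x = w).
  case: t => [[[e o] c] [c' keep]].
  apply: eq_regular (regular_rep_map_head
    (omap2 (tag_head o c) (tag_head o c') \o pairing keep)
    (omap2 tag_tail tag_tail \o pairing keep) e) => w.
  split=> [[h eh <-]|[[[[h o'] c1] [c1' keep']] [eh <- <- <- <-] <-]].
    by exists (h, o, c, (c', keep)); rewrite ?slide_pairE // /slide_type_of /type_of eh.
  by exists h; rewrite ?slide_pairE.
have := regular_substitution
  (regularI (regular_pmap old_type regular_window_types) regular_slide_acc) fibre.
move/(@regular_bounded_delay _ _ (K0 + K0)) => reg.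
apply: eq_regular (reg _) => [c|m [s /slide_typesP[g ->] <-]]; last first.
  exact: paddings_slide.
split=> [[m [s /slide_typesP[g ->] <-] ->]|[g ->]].
  by exists g; rewrite fst_slide snd_slide.
exists (flatten (map slide_pair (slide (window g)))); last by rewrite fst_slide snd_slide.
by exists (slide (window g)) => //; apply/slide_typesP; exists g.
Qed.

(** Moving the cursor to the left is the converse relation: exchange the
    tracks. *)
Lemma regular_code_unshift :
  regular (fun c => exists g, c = convolution (code g) (code (g * shift G (- 1)%R)%g)).
Proof.
apply: eq_regular (regular_map (@swap symbol) regular_code_shift) => c.
have shiftK g : (g * shift G (- 1)%R * shift G 1)%g = g.
  by rewrite -mulgA -shiftD addNr mulg1.
have shiftVK g : (g * shift G 1 * shift G (- 1)%R)%g = g.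
  by rewrite -mulgA -shiftD subrr mulg1.
split=> [[g E]|[g ->]].
  exists (g * shift G 1)%g; rewrite shiftVK -convolution_swap -E -map_comp.
  by rewrite map_id_in // => -[].
by exists (g * shift G (- 1)%R)%g; rewrite shiftK convolution_swap.
Qed.

End Code.

Local Open Scope ring_scope.

(** * Representations given by codes, and word length *)

(** Only the inverse of the bijection has to be given: its values form the
    language, and decoding is a choice of preimages. *)
Lemma cayley_automatic_code (W : groupType) (S : seq W) (B : finType)
    (code : W -> seq B) :
  injective code -> regular (fun w => exists g, w = code g) ->
  (forall s, s \in S ->
     regular (fun c => exists g, c = convolution (code g) (code (g * s)%g))) ->
  exists psi : cayley_automatic_rep S, forall g,
    size (repr_word psi g) = size (code g).
Proof.
move=> inj [M accM] regS.
have langP g : dfa_accept M (code g) by apply/accM; exists g.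
have valP (w : {w | dfa_accept M w}) : exists g, code g == val w.
  by have /accM[g ->] := valP w; exists g.
pose rep g : {w | dfa_accept M w} := Sub (code g) (langP g).
pose value (w : {w | dfa_accept M w}) := xchoose (valP w).
have valueP w : code (value w) = val w by apply/eqP; apply: xchooseP (valP w).
have valK : cancel value rep by move=> w; apply: val_inj; rewrite SubK valueP.
have repK : cancel rep value by move=> g; apply: inj; rewrite valueP SubK.
have regL : regular (dfa_accept M) by exists M.
have regM s : s \in S -> regular (fun c => exists w1 w2 : {w | dfa_accept M w},
    c = convolution (val w1) (val w2) /\ (value w1 * s)%g = value w2).
  move/regS; apply: eq_regular => c; split=> [[g ->]|[w1 [w2 [-> E]]]].
    by exists (rep g), (rep (g * s)%g); rewrite !SubK !repK.
  by exists (value w1); rewrite E !valueP.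
by exists (CayleyAutomaticRep valK repK regL regM).
Qed.

Section WordLengthFacts.
Variables (W : groupType) (S : seq W) (genS : generates S).

Lemma wlengthP g : represents S (wlength genS g) g.
Proof. by rewrite /wlength; case: ex_minnP. Qed.

Lemma wlength_le k g : represents S k g -> (wlength genS g <= k)%N.
Proof. by rewrite /wlength; case: ex_minnP => m _; apply. Qed.

End WordLengthFacts.

Section Length.
Variables (G : groupType) (gs : seq G) (genG : generates gs).
Variables (a : intZ) (gena : generates [:: a]).
Let gens := wreath_gens gs [:: a].
Let genW := wreath_generates genG gena.

(** The generator divides 1. *)
Lemma generator_int : (a : int) = 1 \/ (a : int) = -1.
Proof.
have [k /representsP[u [_ uS]]] := gena (1 : int).
have : exists z : int, (\prod_(s <- u) s)%g = z * (a : int) :> int.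
  elim: u uS => [|x u IHu] uS; first by exists 0; rewrite big_nil mul0r.
  have [y yu|z Ez] := IHu; first by apply: uS; rewrite inE yu orbT.
  rewrite big_cons; have := uS x (mem_head _ _).
  rewrite mem_cat !inE => /orP[]/eqP->.
    exists (1 + z); rewrite mulrDl mul1r -Ez; reflexivity.
  exists (-1 + z); rewrite mulrDl mulN1r -Ez; reflexivity.
move=> [z ->] /(congr1 absz); rewrite abszM => /eqP; rewrite muln_eq1.
case/andP=> _; move: (a : int) => n; lia.
Qed.

Lemma represents_shift (n : int) : represents gens `|n|%N (shift G n).
Proof.
have aS : wreath_top G a \in symmetrize gens.
  by rewrite !mem_cat map_f ?orbT ?mem_head.
have aVS : (wreath_top G a)^-1%g \in symmetrize gens.
  by rewrite mem_cat orbC map_f // mem_cat map_f ?orbT ?mem_head.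
have aV : (wreath_top G a)^-1%g = shift G (- (a : int)).
  by apply: (mulgI (wreath_top G a)); rewrite mulgV -wreath_topM mulgV.
have pm (e : int) : e = 1 \/ e = -1 -> represents gens 1 (shift G e).
  move=> e1; apply: represents_gen.
  have : e = a \/ e = - (a : int).
    by have := generator_int; move: (a : int) => b; lia.
  by case=> ->; rewrite -?aV.
have pow (e : int) m : e = 1 \/ e = -1 -> represents gens m (shift G (e * m%:Z)).
  move=> e1; elim: m => [|m IHm]; first by rewrite mulr0; apply: represents1.
  have -> : e * m.+1%:Z = e * m%:Z + e by rewrite -addn1 PoszD mulrDr mulr1.
  rewrite -addn1 [shift G _]shiftD; exact: representsM IHm (pm e e1).
case: n => n; first by have := pow 1 n; rewrite mul1r; apply; left.
by have := pow (-1) n.+1; rewrite mulN1r NegzE; apply; right.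
Qed.

Lemma represents_light h : represents gens (wlength genG h) (light h).
Proof.
have /representsP[u [<- uS Eh]] := wlengthP genG h.
apply/representsP; exists (map (@light G) u); rewrite size_map; split=> //.
  move=> _ /mapP[x /uS + ->]; rewrite !mem_cat => /orP[xgs|/mapP[s sgs ->]].
    by rewrite map_f.
  rewrite orbC (_ : light _ = (light s)^-1%g) ?map_f ?mem_cat ?map_f //.
  by apply: (mulgI (light s)); rewrite mulgV -wreath_baseM mulgV; apply: wreath_base1.
rewrite big_map -Eh; elim: (u) => [|x v IHv]; first by rewrite !big_nil [light _]wreath_base1.
by rewrite !big_cons IHv [RHS]wreath_baseM.
Qed.

Definition total_length (hs : seq G) := (\sum_(h <- hs) wlength genG h)%N.

Lemma represents_sweep (e : int) hs : e = 1 \/ e = -1 ->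
  represents gens (total_length hs + size hs) (sweep e hs).
Proof.
move=> e1; elim: hs => [|h hs IHhs].
  by rewrite /total_length /sweep !big_nil; apply: represents1.
rewrite sweep_cons /total_length big_cons /= -[(size hs).+1]add1n.
rewrite addnACA [(_ + 1)%N]addnC; apply: representsM IHhs.
apply: representsM (represents_light h).
by have := represents_shift e; case: e1 => ->.
Qed.

(** The first move of the sweep is absorbed in the way to its first lamp; this is
    what makes the count of moves one less than the number of lamps. *)
Lemma represents_tour (e i j : int) hs : e = 1 \/ e = -1 -> hs <> [::] ->
  represents gens (`|i| + total_length hs + (size hs).-1 + `|j|)%N
    (shift G (i - e) * sweep e hs * shift G j)%g.
Proof.
case: hs => // h hs e1 _; apply: representsM (represents_shift j).
rewrite sweep_cons !mulgA -shiftD subrK /total_length big_cons.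
rewrite addnA -[X in represents _ X _]addnA.
apply: representsM (represents_sweep hs e1).
exact: representsM (represents_shift i) (represents_light h).
Qed.

Lemma total_length_rev hs : total_length (rev hs) = total_length hs.
Proof. by rewrite /total_length; apply: perm_big; rewrite perm_rev. Qed.

(** If the cursor ends at or to the right of the origin, then go to the left end
    first, and otherwise to the right end.  The origin has index [k] and the cursor
    has index [z + k]; with [m] cells the moves number at most
    [k + (m - 1) + (m - 1 - (z + k))] in the first case. *)
Lemma wlength_window g :
  (wlength genW g <= total_length (map (@lamp G) (window g))
     + 2 * (size (window g)).-1)%N.
Proof.
have [[k Ek] _] := windowP g; set s := window g in Ek *.
have inside (x : int) : entry g (x - k%:Z) != blank G -> 0 <= x < (size s)%:Z.
  move=> nb; rewrite !ltNge -Ek subrK in nb *; apply/andP; split.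
    by rewrite leNgt; apply: contra nb => lt0; rewrite nthz_neg.
  by apply: contra nb => ge; rewrite nthz_over.
have k_in : 0 <= k%:Z < (size s)%:Z.
  by apply: inside; rewrite subrr !xpair_eqE andbF.
have l_in : 0 <= (g.2 : int) + k%:Z < (size s)%:Z.
  by apply: inside; rewrite addrK !xpair_eqE eqxx andbF.
have s0 : s <> [::] by move=> E; move: k_in; rewrite E /=; lia.
have ms0 : map (@lamp G) s <> [::] by case: (s) s0.
have rs0 : rev (map (@lamp G) s) <> [::].
  by move/(congr1 rev); rewrite revK.
set z := (g.2 : int) in l_in.
have [le_kl|lt_lk] := leP k%:Z (z + k%:Z).
  rewrite (sweep_rightE Ek); apply: leq_trans (wlength_le _ (represents_tour _ _ (or_introl erefl) ms0)) _.
  rewrite size_map -/z; clearbody z s; lia.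
rewrite (sweep_leftE Ek) (_ : (size s)%:Z - k%:Z = ((size s)%:Z - 1 - k%:Z) - (-1)); last by lia.
apply: leq_trans (wlength_le _ (represents_tour _ _ (or_intror erefl) rs0)) _.
rewrite total_length_rev size_rev size_map -/z; clearbody z s; lia.
Qed.

End Length.

(** * The theorem *)

Section LipschitzSize.
Variables (W : groupType) (S : seq W) (f : W -> nat) (K : nat).
Hypothesis stepS : forall s g, s \in S ->
  (f (g * s)%g <= f g + K)%N /\ (f g <= f (g * s)%g + K)%N.

(** The bound in both directions is what covers inverses of generators. *)
Lemma lipschitz_represents k g : represents S k g -> (f g <= f 1%g + K * k)%N.
Proof.
have step s h : s \in symmetrize S -> (f (h * s)%g <= f h + K)%N.
  rewrite mem_cat => /orP[/(stepS h)[]//|/mapP[t /(stepS (h * t^-1)%g)[_ le] ->]].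
  by move: le; rewrite -mulgA mulVg mulg1.
case/representsP=> u [<- uS <-].
have gen h : (f (h * \prod_(s <- u) s)%g <= f h + K * size u)%N.
  elim: u uS h => [|x u IHu] uS h; first by rewrite big_nil mulg1 leq_addr.
  rewrite big_cons mulgA /= mulnS addnA.
  apply: leq_trans (IHu _ _) _; first by move=> y yu; apply: uS; rewrite inE yu orbT.
  by rewrite leq_add2r step // uS ?mem_head.
by have := gen 1%g; rewrite mul1g.
Qed.
End LipschitzSize.

Theorem theorem3 (R : realFieldType)
    (G : groupType) (n : nat) (gs : n.-tuple G) (genG : generates gs)
    (psiG : cayley_automatic_rep gs) (nil_psiG : ~~ car_lang psiG [::])
    (a : intZ) (gena : generates [:: a])
    (d : 'I_n -> nat)
    (d_max : forall j, is_maximum (padding_number psiG (tnth gs j)) (d j)) :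
  let K0 := size (repr_word psiG 1%g) in
  let K := maxn K0 (\max_(j < n) d j) in
  let genW := wreath_generates genG gena in
  exists psi : cayley_automatic_rep (wreath_gens gs [:: a]),
    (forall g : wreath G intZ,
       K%:R^-1 * (size (repr_word psi g))%:R - K0%:R / K%:R
         <= (wlength genW g)%:R :> R)
    /\
    (forall C D : R, 0 < C -> 0 <= D ->
       (forall g : G,
          (wlength genG g)%:R <= C * (size (repr_word psiG g))%:R + D) ->
       forall g : wreath G intZ,
         (wlength genW g)%:R
           <= (C + D + 2) * (size (repr_word psi g))%:R - 2).
Proof.
move=> K0 K genW.
have lampP h : h \in (gs : seq G) -> exists2 e, (e <= K)%N &
    forall g, (paddings (convolution (repr_word psiG g)
      (repr_word psiG (g * h)%g)) <= e)%N.
  case/tnthP=> j ->; exists (d j).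
    by apply: leq_trans (leq_maxr _ _); apply: leq_bigmax.
  by move=> g; have [_ le_d] := d_max j; apply: le_d; exists g.
have K0_le : (K0 <= K)%N by apply: leq_maxl.
have K_gt0 : (0 < K)%N by apply: leq_trans K0_le; apply: size_rep_gt0.
have [|||psi size_psi] := @cayley_automatic_code _ (wreath_gens gs [:: a]) _ (@code _ _ psiG).
- exact: code_inj.
- exact: regular_code.
- move=> s; rewrite mem_cat => /orP[/mapP[h hgs ->]|].
    have [e _ le_e] := lampP h hgs; exact: regular_code_light hgs le_e.
  rewrite mem_seq1 => /eqP->.
  have [->|->] := generator_int gena; first exact: regular_code_shift.
  exact: regular_code_unshift.
exists psi; split=> [g|C D C_gt0 D_ge0 leC g]; rewrite size_psi.
  have step s h : s \in wreath_gens gs [:: a] ->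
      (size (code psiG (h * s)%g) <= size (code psiG h) + K)%N /\
      (size (code psiG h) <= size (code psiG (h * s)%g) + K)%N.
    rewrite mem_cat => /orP[/mapP[h0 hgs ->]|].
      have [e le_eK le_e] := lampP h0 hgs.
      have [le1 le2] := size_code_light le_e h.
      split; [apply: leq_trans le1 _|apply: leq_trans le2 _]; by rewrite leq_add2l.
    rewrite mem_seq1 => /eqP->.
    have [->|->] := generator_int gena.
      have [le1 le2] := size_code_shift psiG h.
      split; [apply: leq_trans le1 _|apply: leq_trans le2 _]; by rewrite leq_add2l.
    have [] := size_code_shift psiG (h * shift G (-1))%g.
    rewrite -mulgA -shiftD addNr mulg1 => le1 le2.
    split; [apply: leq_trans le2 _|apply: leq_trans le1 _]; by rewrite leq_add2l.
  have := lipschitz_represents step (wlengthP genW g).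
  rewrite {2}/code window1 size_word_cons size_block addn0 -/K0 => le_size.
  rewrite mulrC -mulrBl ler_pdivrMr ?ltr0n // lerBlDl -natrM -natrD ler_nat.
  by rewrite mulnC.
have le_tot s : (total_length genG (map (@lamp G) s))%:R
    <= C * (size (word psiG s))%:R + D * (size s)%:R :> R.
  elim: s => [|b s IHs]; first by rewrite /total_length big_nil !mulr0 addr0.
  rewrite /total_length /= big_cons size_word_cons size_block !natrD.
  rewrite -[(size s).+1]addn1 natrD.
  move: IHs (leC (lamp b)); rewrite /total_length; lra.
have le_size s : (size s <= size (word psiG s))%N.
  elim: s => // b s IHs; rewrite size_word_cons size_block /=.
  by rewrite -add1n leq_add // (size_rep_gt0 nil_psiG).
have := wlength_window genG gena g; rewrite -(ler_nat R) natrD natrM => le_w.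
have := le_tot (window g); have := le_size (window g); rewrite -/(code _ g).
rewrite -(ler_nat R) => le_m le_t.
have m_gt0 : (0 < size (window g))%N.
  by have [_] := windowP g; case: (window g) => //; rewrite /trimmed eqxx.
have Em : (size (window g)).-1%:R = (size (window g))%:R - 1 :> R.
  by rewrite -subn1 natrB.
move: le_w; rewrite Em => le_w.
have le_Dm : D * (size (window g))%:R <= D * (size (code psiG g))%:R.
  exact: ler_wpM2l.
lra.
Qed.
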